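(* Let $\mathfrak A$ and $\mathfrak B$ be self-induced Banach algebras and let $\mathfrak M=\mathfrak M(\mathfrak A,\mathfrak B,P,Q,\{\cdot,\cdot\},[\cdot,\cdot])$ be a full Morita context. Then $$\mathcal H^1_{\mathfrak M}(\mathfrak A,\mathfrak A^* )\cong\mathcal H^1_{\mathfrak M}(\mathfrak B,\mathfrak B^* )$$ (isomorphism of vector spaces).
   Context: All Banach spaces are complex; all modules are Banach modules and all (multi)linear maps are bounded. For a right Banach $\mathfrak A$-module $P$ and a left Banach $\mathfrak A$-module $Q$, $P\widehat\otimes_{\mathfrak A}Q=(P\widehat\otimes Q)/N$, where $\widehat\otimes$ is the projective tensor product and $N$ is the closed linear span of $\{pa\otimes q-p\otimes aq\}$. A Banach algebra $\mathfrak A$ is self-induced if the map $\mathfrak A\widehat\otimes_{\mathfrak A}\mathfrak A\to\mathfrak A$ implemented by multiplication is a (topological) isomorphism. Morita context: $\mathfrak A,\mathfrak B$ are self-induced Banach algebras, $P$ is a Banach $\mathfrak A$-$\mathfrak B$-bimodule, $Q$ is a Banach $\mathfrak B$-$\mathfrak A$-bimodule, and $\{\cdot,\cdot\}:P\times Q\to\mathfrak A$, $[\cdot,\cdot]:Q\times P\to\mathfrak B$ are bounded balanced bilinear maps ($\{pb,q\}=\{p,bq\}$, $[qa,p]=[q,ap]$) which implement bimodule homomorphisms $P\widehat\otimes_{\mathfrak B}Q\to\mathfrak A$ and $Q\widehat\otimes_{\mathfrak A}P\to\mathfrak B$ and satisfy $\{p,q\}p'=p[q,p']$ and $[q,p]q'=q\{p,q'\}$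 for all $p,p'\in P$, $q,q'\in Q$. These data are written $\mathfrak M(\mathfrak A,\mathfrak B,P,Q,\{\cdot,\cdot\},[\cdot,\cdot])$. The context is full if both implemented homomorphisms are (topological) isomorphisms. The dual $\mathfrak A^*$ is an $\mathfrak A$-bimodule via $\langle x,a\cdot f\rangle=\langle xa,f\rangle$, $\langle x,f\cdot a\rangle=\langle ax,f\rangle$. A derivation is a bounded linear $D:\mathfrak A\to\mathfrak A^*$ with $D(ab)=a\cdot D(b)+D(a)\cdot b$; it is inner if $D(a)=a\cdot f-f\cdot a$ for some $f\in\mathfrak A^*$. $\mathcal B^1(\mathfrak A,\mathfrak A^* )$ is the space of inner derivations. $\mathcal Z^1_{\mathfrak M}(\mathfrak A,\mathfrak A^* )$ is the space of derivations $D:\mathfrak A\to\mathfrak A^*$ for which there is a bounded bilinear form $\psi:P\times Q\to\mathbb C$ with $\langle\{p,q\},D(a)\rangle=\psi(ap,q)-\psi(p,qa)$ for all $p\in P,q\in Q,a\in\mathfrak A$, and $\mathcal H^1_{\mathfrak M}(\mathfrak A,\mathfrak A^* )=\mathcal Z^1_{\mathfrak M}(\mathfrak A,\mathfrak A^* )/\mathcal B^1(\mathfrak A,\mathfrak A^* )$. Analogously, $\mathcal Z^1_{\mathfrak M}(\mathfrak B,\mathfrak B^* )$ is the space of derivations $D:\mathfrak B\to\mathfrak B^*$ for which there is a bounded bilinear form $\psi:Q\times P\to\mathbb C$ with $\langle[q,p],D(b)\rangle=\psi(bq,p)-\psi(q,pb)$ for all $q,p,b$, and $\mathcal H^1_{\mathfrak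 M}(\mathfrak B,\mathfrak B^* )=\mathcal Z^1_{\mathfrak M}(\mathfrak B,\mathfrak B^* )/\mathcal B^1(\mathfrak B,\mathfrak B^* )$. *)

(* Defs.v *)
From HB Require Import structures.
From mathcomp Require Import all_boot all_order all_algebra.
From mathcomp Require Import generic_quotient ring_quotient freeg complex.
From mathcomp Require Import all_classical all_reals topology normedtype sequences.
From mathcomp Require Import interval_inference lra.

Set Implicit Arguments.
Unset Strict Implicit.
Unset Printing Implicit Defensive.

Import Order.TTheory GRing.Theory Num.Theory.
Import numFieldNormedType.Exports.
Import Quotient.Exports.

Local Open Scope classical_set_scope.
Local Open Scope quotient_scope.
Local Open Scope ring_scope.
Local Open Scope complex_scope.

Record subspace (F : pzRingType) (V : lmodType F) := Subspace {
  subspace_pred :> {pred V};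
  subspaceP : submod_closed subspace_pred
}.

HB.instance Definition _ (F : pzRingType) (V : lmodType F) (W : subspace V) :=
  GRing.isSubmodClosed.Build F V (subspace_pred W) (subspaceP W).

Section Submodule.
Variables (F : pzRingType) (V : lmodType F) (W : subspace V).

Definition submod : Type := {x : V | x \in subspace_pred W}.
HB.instance Definition _ := [isSub of submod for @sval V _].
HB.instance Definition _ := [Choice of submod by <:].
HB.instance Definition _ := [SubChoice_isSubLmodule of submod by <:].

End Submodule.

Section QuotientModule.
Variables (F : pzRingType) (V : lmodType F) (I : subspace V).

Definition quotmod : Type := Quotient.quot (GRing.ZmodClosed.clone V (subspace_pred I) _).
HB.instance Definition _ := Choice.on quotmod.
HB.instance Definition _ := EqQuotient.on quotmod.
HB.instance Definition _ := GRing.Zmodule.on quotmod.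
HB.instance Definition _ := ZmodQuotient.on quotmod.

Definition qclass (x : V) : quotmod := \pi_(quotmod) x.
Definition qrepr (x : quotmod) : V := repr x.

Lemma qreprK : cancel qrepr qclass.
Proof. exact: reprK. Qed.

Lemma qclass_eq x y : (qclass x = qclass y) <-> (x - y \in I).
Proof.
split; first by move/eqP; rewrite -(Quotient.idealrBE (GRing.ZmodClosed.clone V (subspace_pred I) _)).
by move=> h; apply/eqP; rewrite -(Quotient.idealrBE (GRing.ZmodClosed.clone V (subspace_pred I) _)).
Qed.

Lemma qclassD x y : qclass (x + y) = qclass x + qclass y.
Proof. by rewrite /qclass !piE. Qed.

Definition qscale (a : F) (x : quotmod) : quotmod := qclass (a *: qrepr x).

Lemma qscaleE a x : qscale a (qclass x) = qclass (a *: x).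
Proof.
apply/qclass_eq; rewrite -scalerBr rpredZ//; apply/qclass_eq.
exact: qreprK.
Qed.

Fact qscaleA a b x : qscale a (qscale b x) = qscale (a * b) x.
Proof. by rewrite -[x]qreprK !qscaleE scalerA. Qed.
Fact qscale1 : left_id 1 qscale.
Proof. by move=> x; rewrite -[x]qreprK qscaleE scale1r. Qed.
Fact qscaleDr : right_distributive qscale +%R.
Proof.
by move=> a x y; rewrite -[x]qreprK -[y]qreprK -qclassD !qscaleE scalerDr qclassD.
Qed.
Fact qscaleDl x : {morph qscale^~ x : a b / a + b}.
Proof. by move=> a b; rewrite -[x]qreprK !qscaleE scalerDl qclassD. Qed.

HB.instance Definition _ :=
  GRing.Zmodule_isLmodule.Build F quotmod qscaleA qscale1 qscaleDr qscaleDl.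

Fact qclass_linear : linear qclass.
Proof. by move=> a x y; rewrite qclassD -[RHS]/(qscale _ _ + _) qscaleE. Qed.
HB.instance Definition _ := GRing.isLinear.Build F V quotmod _ qclass qclass_linear.

Lemma qclassZ a x : qclass (a *: x) = a *: qclass x.
Proof. exact: linearZ. Qed.

Lemma qclassB x y : qclass (x - y) = qclass x - qclass y.
Proof. exact: linearB. Qed.

End QuotientModule.

Lemma qclass_inj0 (F : pzRingType) (V : lmodType F) (I : subspace V) (x : V) :
  (qclass I x = 0) <-> (x \in I).
Proof. by rewrite -(linear0 (qclass I)) qclass_eq subr0. Qed.

Section Span.
Variables (F : pzRingType) (V : lmodType F).

Definition lspan_pred (S : set V) : {pred V} := fun x =>
  `[< forall W : subspace V, S `<=` [set y | y \in W] -> x \in W >].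

Fact lspan_submod S : submod_closed (lspan_pred S).
Proof.
split; first by apply/asboolP => W _; exact: (subspaceP W).1.
move=> a x y /asboolP hx /asboolP hy; apply/asboolP => W SW.
by apply: (subspaceP W).2; [exact: hx|exact: hy].
Qed.
Definition lspan (S : set V) : subspace V := Subspace (lspan_submod S).

Lemma sub_lspan (S : set V) x : S x -> x \in lspan S.
Proof. by move=> Sx; apply/asboolP => W; apply. Qed.

Lemma lspan_ind (S : set V) (W : subspace V) :
  S `<=` [set y | y \in W] -> forall x, x \in lspan S -> x \in W.
Proof. by move=> SW x /asboolP; apply. Qed.

End Span.

Section RealNorm.
Variable R : realType.

(* The norm of a normed space over R[i] has values in R[i]; rnorm is the same
   norm as an element of R (see rnormE), where inf, sup and limits are taken. *)
Definition rnorm (V : normedZmodType R[i]) (x : V) : R := complex.Re `|x|.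

Variable V : normedZmodType R[i].
Implicit Types x y : V.

Lemma rnormE x : (rnorm x)%:C = `|x|.
Proof. by rewrite RRe_real// realE normr_ge0. Qed.

Lemma rnorm_ge0 x : 0 <= rnorm x.
Proof. by rewrite -lecR rnormE normr_ge0. Qed.

Lemma ler_rnormD x y : rnorm (x + y) <= rnorm x + rnorm y.
Proof. by rewrite -lecR rmorphD/= !rnormE ler_normD. Qed.

Lemma rnorm0 : rnorm (0 : V) = 0.
Proof. by rewrite /rnorm normr0. Qed.

Lemma rnormN x : rnorm (- x) = rnorm x.
Proof. by rewrite /rnorm normrN. Qed.

Lemma rnorm0_eq0 x : rnorm x = 0 -> x = 0.
Proof. by move=> x0; apply/normr0_eq0; rewrite -rnormE x0. Qed.

End RealNorm.

Lemma rnormZ (R : realType) (V : normedModType R[i]) (a : R[i]) (x : V) :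
  rnorm (a *: x) = rnorm a * rnorm x.
Proof.
by apply: (@complexI R); rewrite rmorphM/= !rnormE normrZ.
Qed.

Record seminorm (R : realType) (V : lmodType R[i]) := Seminorm {
  seminorm_fun :> V -> R;
  seminormD : forall x y, seminorm_fun (x + y) <= seminorm_fun x + seminorm_fun y;
  seminormZ : forall a x, seminorm_fun (a *: x) = rnorm a * seminorm_fun x
}.

Section SeminormTheory.
Variables (R : realType) (V : lmodType R[i]) (s : seminorm V).

Lemma seminorm0 : s 0 = 0.
Proof. by rewrite -(scale0r 0) seminormZ rnorm0 mul0r. Qed.

Lemma seminormN x : s (- x) = s x.
Proof. by rewrite -scaleN1r seminormZ rnormN /rnorm normr1 mul1r. Qed.

Lemma seminormB x y : s (x - y) = s (y - x).
Proof. by rewrite -opprB seminormN. Qed.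

Lemma seminorm_ge0 x : 0 <= s x.
Proof.
have := seminormD s x (- x); rewrite subrr seminorm0 seminormN.
by rewrite -mulr2n pmulrn_lge0.
Qed.

Lemma seminorm_dist x y : `|s x - s y| <= s (x - y).
Proof.
have hx : s x <= s (x - y) + s y by rewrite -{1}(subrK y x) seminormD.
have hy : s y <= s (x - y) + s x.
  by rewrite seminormB -{1}(subrK x y) seminormD.
by rewrite ler_norml lerBlDr hx andbT lerNl opprB lerBlDr.
Qed.

End SeminormTheory.

(* Hausdorff completion of a seminormed space (V, s): Cauchy sequences modulo
   null sequences, normed by u |-> lim s(u_n). *)
Section Completion.
Variables (R : realType) (V : lmodType R[i]) (s : seminorm V).

Definition cseq_pred : {pred nat -> V} := fun u =>
  `[< forall e : R, 0 < e -> exists N, forall m n,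
        (N <= m)%N -> (N <= n)%N -> s (u m - u n) < e >].

Fact cseq_submod : submod_closed cseq_pred.
Proof.
split.
  apply/asboolP => e e0; exists 0%N => m n _ _.
  by rewrite [X in s X](_ : _ = 0) ?seminorm0//; exact: subrr.
move=> a u v /asboolP hu /asboolP hv; apply/asboolP => e e0.
have e20 : 0 < e / 2 by rewrite divr_gt0.
have a0 : 0 < rnorm a + 1 by rewrite ltr_wpDl// rnorm_ge0.
have [N1 h1] := hu (e / 2 / (rnorm a + 1)) (divr_gt0 e20 a0).
have [N2 h2] := hv (e / 2) e20.
exists (maxn N1 N2) => m n; rewrite !geq_max => /andP[m1 m2] /andP[n1 n2].
have -> : (a *: u + v) m - (a *: u + v) n = a *: (u m - u n) + (v m - v n).
  by rewrite -[LHS]/(a *: u m + v m - (a *: u n + v n)) scalerBr opprD addrACA.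
apply: (le_lt_trans (seminormD _ _ _)); rewrite seminormZ (splitr e).
apply: ler_ltD; last exact: h2.
have := h1 m n m1 n1; rewrite ltr_pdivlMr// => /ltW; apply: le_trans.
rewrite mulrC ler_wpM2l// ?seminorm_ge0// lerDl//.
Qed.

Definition cseq : Type := submod (Subspace cseq_submod).
HB.instance Definition _ := GRing.Lmodule.on cseq.
Definition seq_of (u : cseq) : nat -> V := sval u.

Lemma seq_ofP u : forall e : R, 0 < e -> exists N, forall m n,
  (N <= m)%N -> (N <= n)%N -> s (seq_of u m - seq_of u n) < e.
Proof. by apply/asboolP; case: u. Qed.

Lemma seq_ofZD a u v n : seq_of (a *: u + v) n = a *: seq_of u n + seq_of v n.
Proof. by []. Qed.

Lemma seq_of0 n : seq_of 0 n = 0.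
Proof. by []. Qed.

Lemma seq_ofB u v n : seq_of (u - v) n = seq_of u n - seq_of v n.
Proof. by []. Qed.

Definition null_pred : {pred cseq} := fun u =>
  `[< s \o seq_of u @ \oo --> 0 >].

Fact null_submod : submod_closed null_pred.
Proof.
split.
  apply/asboolP; rewrite (_ : _ \o _ = cst 0); first exact: cvg_cst.
  by apply/funext => n; exact: seminorm0.
move=> a u v /asboolP hu /asboolP hv; apply/asboolP.
apply: (@squeeze_cvgr _ _ _ _ (cst 0)
  (fun n => rnorm a * (s \o seq_of u) n + (s \o seq_of v) n)).
- apply: nearW => n; rewrite [X in _ <= X <= _]/comp seminorm_ge0 andTb.
  by apply: (le_trans (seminormD s (a *: seq_of u n) (seq_of v n))); rewrite seminormZ.
- exact: cvg_cst.
- rewrite -[X in _ --> X](addr0 0) -[X in _ --> X + _](mulr0 (rnorm a)).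
  by apply: cvgD => //; apply: cvgMl_tmp.
Qed.

Definition completion : Type := quotmod (Subspace null_submod).
HB.instance Definition _ := GRing.Lmodule.on completion.

Definition cclass (u : cseq) : completion := qclass _ u.
Definition crepr (x : completion) : cseq := qrepr x.
Definition cnormR (x : completion) : R := limn (s \o seq_of (crepr x)).

Lemma cvg_seminorm (u : cseq) : cvgn (s \o seq_of u).
Proof.
apply: R_complete; apply: cauchy_exP => e e0.
have [N hN] := seq_ofP u e0.
exists (s (seq_of u N)); exists N => // n /= Nn; rewrite -ball_normE /=.
exact: (le_lt_trans (seminorm_dist _ _ _) (hN _ _ (leqnn _) Nn)).
Qed.

Lemma lim_eq_null (u v : cseq) : u - v \in null_pred ->
  limn (s \o seq_of u) = limn (s \o seq_of v).
Proof.
move=> /asboolP uv0; apply/subr0_eq.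
rewrite -limB; [|exact: cvg_seminorm..].
apply: cvg_lim => //; apply/cvgr0Pnorm_lt => e e0.
move/cvgr0Pnorm_lt : uv0 => /(_ e e0); apply: filterS => n.
apply: le_lt_trans.
rewrite [X in _ <= `|X|](_ : _ = s (seq_of u n - seq_of v n))//.
by rewrite [leRHS]ger0_norm ?seminorm_ge0//; exact: seminorm_dist.
Qed.

Lemma crepr_null (u : cseq) : crepr (cclass u) - u \in null_pred.
Proof. by apply/(qclass_eq (Subspace null_submod)); exact: qreprK. Qed.

Lemma cnormR_class (u : cseq) : cnormR (cclass u) = limn (s \o seq_of u).
Proof. exact/lim_eq_null/crepr_null. Qed.

Lemma creprK : cancel crepr cclass.
Proof. exact: qreprK. Qed.

Lemma cclassZD a u v : cclass (a *: u + v) = a *: cclass u + cclass v.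
Proof. exact: linearP. Qed.

Definition cnorm (x : completion) : R[i] := (cnormR x)%:C.

Lemma cclass_surj (x : completion) : exists u, x = cclass u.
Proof. by exists (crepr x); rewrite creprK. Qed.

Fact ler_cnormD x y : cnorm (x + y) <= cnorm x + cnorm y.
Proof.
have [u ->] := cclass_surj x; have [v ->] := cclass_surj y.
rewrite -[_ + cclass v](qclassD (Subspace null_submod)).
rewrite -rmorphD/= lecR !cnormR_class -limD; [|exact: cvg_seminorm..].
apply: ler_lim; [exact: cvg_seminorm|by apply: is_cvgD; exact: cvg_seminorm|].
apply: nearW => n; exact: (seminormD s (seq_of u n) (seq_of v n)).
Qed.

Fact cnormZ (a : R[i]) x : cnorm (a *: x) = `|a| * cnorm x.
Proof.
have [u ->] := cclass_surj x.
rewrite -[_ *: cclass u](qclassZ (Subspace null_submod)).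
rewrite -rnormE -rmorphM/=; congr (_%:C).
rewrite !cnormR_class; apply: cvg_lim => //.
rewrite (_ : s \o _ = fun n => rnorm a * (s \o seq_of u) n).
  by apply: cvgMl_tmp; exact: cvg_seminorm.
by apply/funext => n; exact: (seminormZ s a (seq_of u n)).
Qed.

Fact cnorm0_eq0 x : cnorm x = 0 -> x = 0.
Proof.
move=> /(@complexI R); have [u ->] := cclass_surj x; rewrite cnormR_class => u0.
apply/qclass_inj0/asboolP; rewrite -u0; exact: cvg_seminorm.
Qed.

HB.instance Definition _ :=
  Lmodule_isNormed.Build R[i] completion ler_cnormD cnormZ cnorm0_eq0.

Lemma rnorm_completion (x : completion) : rnorm x = cnormR x.
Proof. by []. Qed.

Fact cst_cseq (x : V) : (fun _ : nat => x) \in cseq_pred.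
Proof.
by apply/asboolP => e e0; exists 0%N => m n _ _; rewrite subrr seminorm0.
Qed.

Definition cinj (x : V) : completion := cclass (exist (fun u => u \in cseq_pred) (fun=> x) (cst_cseq x)).

Fact cinj_linear : linear cinj.
Proof.
by move=> a x y; rewrite /cinj -cclassZD; congr cclass; exact: val_inj.
Qed.
HB.instance Definition _ := GRing.isLinear.Build R[i] V completion _ cinj cinj_linear.

Lemma rnorm_cinj (x : V) : rnorm (cinj x) = s x.
Proof.
rewrite rnorm_completion cnormR_class.
rewrite (_ : s \o _ = fun=> s x); last by apply/funext.
exact: (lim_cst (@Rhausdorff R)).
Qed.

Lemma cinj_dense (x : completion) (e : R) : 0 < e -> exists v, rnorm (x - cinj v) < e.
Proof.
move=> e0; have e20 : 0 < e / 2 by rewrite divr_gt0.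
have [N hN] := seq_ofP (crepr x) e20; exists (seq_of (crepr x) N).
apply: (@le_lt_trans _ _ (e / 2)); last by rewrite ltr_pdivrMr// ltr_pMr// ltrDl.
rewrite -{1}[x]creprK -[_ - cinj _](qclassB (Subspace null_submod)) rnorm_completion cnormR_class.
apply: limr_le; first exact: cvg_seminorm.
exists N => // n /= Nn; apply/ltW.
exact: (hN n N Nn (leqnn _)).
Qed.

End Completion.

Section CompletionComplete.
Variables (R : realType) (V : lmodType R[i]) (s : seminorm V).

Lemma rnorm_lt (W : normedZmodType R[i]) (x : W) (e : R) :
  (`|x| < e%:C) = (rnorm x < e).
Proof. by rewrite -rnormE ltcR. Qed.

Lemma rnormB (W : normedZmodType R[i]) (x y : W) : rnorm (x - y) = rnorm (y - x).
Proof. by rewrite -rnormN opprB. Qed.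

Lemma rnormB_le (W : normedZmodType R[i]) (x y z : W) :
  rnorm (x - z) <= rnorm (x - y) + rnorm (y - z).
Proof. by rewrite -(subrKA y x (- z)) ler_rnormD. Qed.

Lemma inv_lt (e : R) : (0 < e)%R -> exists N, forall n, (N <= n)%N -> n.+1%:R^-1 < e.
Proof.
move: e => _ /posnumP[e]; have [N _ hN] := near_infty_natSinv_lt e.
by exists N => n; exact: hN.
Qed.

Lemma cinjB (x y : V) : cinj s (x - y) = cinj s x - cinj s y.
Proof. exact: linearB. Qed.

Let aux1 (a b c d p q e : R) : a < p -> b < q -> c < p + q -> d <= c + b ->
  p < e / 4 -> q < e / 4 -> a + d < e.
Proof. lra. Qed.

Let aux2 (a b c d p e : R) : 0 < e -> a <= e / 4 -> b < p -> c < p -> d <= b + c ->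
  p < e / 4 -> a + d < e.
Proof. lra. Qed.

Fact completion_cauchy_cvg (F : set_system (completion s)) :
  ProperFilter F -> cauchy F -> cvg F.
Proof.
move=> PF /cauchyP cF.
have F_ex n : exists x, F (ball x (n.+1%:R^-1)%:C).
  by apply: cF; rewrite ltcR invr_gt0.
have [x Fx] := choice F_ex.
have v_ex n : exists w, rnorm (x n - cinj s w) < n.+1%:R^-1.
  by apply: cinj_dense; rewrite invr_gt0.
have [v xv] := choice v_ex.
have xx m n : rnorm (x m - x n) < m.+1%:R^-1 + n.+1%:R^-1.
  have [y []] := filter_ex (filterI (Fx m) (Fx n)).
  rewrite -!ball_normE /= !rnorm_lt => ym yn.
  by apply: (le_lt_trans (rnormB_le _ y _)); rewrite ltrD// rnormB.
have vC : v \in cseq_pred s.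
  apply/asboolP => e e0.
  have e4 : 0 < e / 4 by rewrite divr_gt0.
  have [N hN] := inv_lt e4; exists N => m n /hN Nm /hN Nn.
  rewrite -(rnorm_cinj s) cinjB.
  apply: (le_lt_trans (rnormB_le _ (x m) _)).
  rewrite rnormB; apply: aux1 (xv m) (xv n) (xx m n) _ Nm Nn.
  exact: rnormB_le.
pose l := cclass (exist (fun u => u \in cseq_pred s) v vC).
apply/cvg_ex; exists l; apply/cvgrPdist_lt => e e0.
have eE : e = (complex.Re e)%:C by rewrite RRe_real// realE ltW.
move: e0; rewrite eE ltcR; set d := complex.Re e => d0.
have d4 : 0 < d / 4 by rewrite divr_gt0.
have /asboolP /(_ _ d4) [N1 h1] := vC.
have [N2 h2] := inv_lt d4.
pose n := maxn N1 N2.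
have ln : rnorm (l - cinj s (v n)) <= d / 4.
  rewrite /l /cinj -[cclass _ - _](qclassB (Subspace (null_submod s))).
  rewrite rnorm_completion cnormR_class.
  apply: limr_le; first exact: cvg_seminorm.
  exists N1 => // m /= Nm; apply/ltW.
  exact: (h1 m n Nm (leq_maxl _ _)).
apply: filterS (Fx n) => y; rewrite -ball_normE /= !rnorm_lt => xy.
apply: (le_lt_trans (rnormB_le _ (cinj s (v n)) _)).
apply: aux2 d0 ln (xv n) xy _ (h2 n (leq_maxr _ _)).
by rewrite (rnormB (x n)); exact: rnormB_le.
Qed.

HB.instance Definition _ := Uniform_isComplete.Build (completion s) completion_cauchy_cvg.

End CompletionComplete.

Lemma homogeneous_of_le (R : realType) (V : lmodType R[i]) (q : V -> R) :
  (forall x, 0 <= q x) -> (forall a x, q (a *: x) <= rnorm a * q x) ->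
  forall a x, q (a *: x) = rnorm a * q x.
Proof.
move=> q0 qZ a x; apply/eqP; rewrite eq_le qZ /=.
have [->|a0] := eqVneq a 0; first by rewrite rnorm0 mul0r.
have a_gt0 : 0 < rnorm a.
  by rewrite lt_def rnorm_ge0 andbT; apply: contra_neq a0; exact: rnorm0_eq0.
have aV : rnorm a^-1 = (rnorm a)^-1.
  by apply: (@complexI R); rewrite fmorphV/= !rnormE normfV.
have := qZ a^-1 (a *: x).
by rewrite scalerA mulVf// scale1r aV mulrC ler_pdivlMr// mulrC.
Qed.

(* cspan S is the closed linear span of S, and cquot S is X / cspan S with the
   quotient norm. *)
Section ClosedSpan.
Variables (R : realType) (X : normedModType R[i]) (S : set X).

Definition cspan_pred : {pred X} :=
  fun x => `[< closure [set y | y \in lspan S] x >].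

Lemma closure_rnormP (D : set X) (x : X) :
  closure D x <-> forall e : R, 0 < e -> exists2 y, D y & rnorm (x - y) < e.
Proof.
split=> [clx e e0|h B].
  have /clx[y [Dy]] : nbhs x (ball x e%:C) by apply: nbhsx_ballx; rewrite ltcR.
  by rewrite -ball_normE /= rnorm_lt; exists y.
move=> /nbhs_ballP[e /= e0 eB].
have eE : e = (complex.Re e)%:C by rewrite RRe_real// realE ltW.
move: e0 eB; rewrite eE ltcR => e0 eB.
have [y Dy xy] := h _ e0; exists y; split => //.
by apply: eB; rewrite -ball_normE /= rnorm_lt.
Qed.

Fact cspan_submod : submod_closed cspan_pred.
Proof.
split.
  apply/asboolP/subset_closure; rewrite /=; exact: (subspaceP (lspan S)).1.
move=> a x y /asboolP/closure_rnormP hx /asboolP/closure_rnormP hy.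
apply/asboolP/closure_rnormP => e e0.
have e20 : 0 < e / 2 by rewrite divr_gt0.
have a0 : 0 < rnorm a + 1 by rewrite ltr_wpDl// rnorm_ge0.
have [x' Sx' xx'] := hx (e / 2 / (rnorm a + 1)) (divr_gt0 e20 a0).
have [y' Sy' yy'] := hy (e / 2) e20.
exists (a *: x' + y'); first exact: (subspaceP (lspan S)).2.
have -> : a *: x + y - (a *: x' + y') = a *: (x - x') + (y - y').
  by rewrite scalerBr opprD addrACA.
apply: (le_lt_trans (ler_rnormD _ _)); rewrite rnormZ (splitr e).
apply: ler_ltD => //; move: xx'; rewrite ltr_pdivlMr// => /ltW; apply: le_trans.
by rewrite mulrC ler_wpM2l// ?rnorm_ge0// lerDl.
Qed.

Definition cspan : subspace X := Subspace cspan_submod.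

Definition cquot : Type := quotmod cspan.
HB.instance Definition _ := GRing.Lmodule.on cquot.

Definition cqclass (x : X) : cquot := qclass cspan x.

Fact cqclass_linear : linear cqclass.
Proof. exact: (qclass_linear cspan). Qed.
HB.instance Definition _ :=
  GRing.isLinear.Build R[i] X cquot _ cqclass cqclass_linear.

Lemma cqclass_surj (x : cquot) : exists z, x = cqclass z.
Proof. by exists (qrepr x); rewrite /cqclass qreprK. Qed.

Definition cqnormR (x : cquot) : R :=
  inf [set rnorm z | z in [set z | cqclass z = x]].

Let E x := [set rnorm z | z in [set z | cqclass z = x]].

Let E_neq0 x : E x !=set0.
Proof. by have [z ->] := cqclass_surj x; exists (rnorm z), z. Qed.

Let E_lb x : lbound (E x) 0.
Proof. by move=> _ [z _ <-]; exact: rnorm_ge0. Qed.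

Lemma cqnormR_ge0 x : 0 <= cqnormR x.
Proof. by apply: lb_le_inf; [exact: E_neq0|exact: E_lb]. Qed.

Lemma cqnormR_le z : cqnormR (cqclass z) <= rnorm z.
Proof. by apply: ge_inf; [exists 0; exact: E_lb|exists z]. Qed.

Lemma cqnormR_D x y : cqnormR (x + y) <= cqnormR x + cqnormR y.
Proof.
rewrite -lerBlDr; apply: lb_le_inf; [exact: E_neq0|] => _ [z /= zx <-].
rewrite lerBlDr -lerBlDl; apply: lb_le_inf; [exact: E_neq0|] => _ [w /= wy <-].
rewrite lerBlDl; apply: le_trans (ler_rnormD _ _).
by rewrite -zx -wy -[_ + _](qclassD cspan); exact: cqnormR_le.
Qed.

Lemma cqnormR_Z a x : cqnormR (a *: x) = rnorm a * cqnormR x.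
Proof.
apply: homogeneous_of_le => {a x} [x|a x]; first exact: cqnormR_ge0.
have [->|a0] := eqVneq a 0.
  rewrite scale0r rnorm0 mul0r -[0](linear0 cqclass).
  by apply: le_trans (cqnormR_le _) _; rewrite rnorm0.
have a_gt0 : 0 < rnorm a.
  by rewrite lt_def rnorm_ge0 andbT; apply: contra_neq a0; exact: rnorm0_eq0.
rewrite -ler_pdivrMl//; apply: lb_le_inf; [exact: E_neq0|] => _ [z /= zx <-].
rewrite ler_pdivrMl// -rnormZ -zx -[_ *: _](qclassZ cspan).
exact: cqnormR_le.
Qed.

Definition cqnorm (x : cquot) : R[i] := (cqnormR x)%:C.

Fact ler_cqnormD x y : cqnorm (x + y) <= cqnorm x + cqnorm y.
Proof. by rewrite -rmorphD/= lecR cqnormR_D. Qed.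

Fact cqnormZ (a : R[i]) x : cqnorm (a *: x) = `|a| * cqnorm x.
Proof. by rewrite -rnormE -rmorphM/= -cqnormR_Z. Qed.

Fact cqnorm0_eq0 x : cqnorm x = 0 -> x = 0.
Proof.
move=> /(@complexI R); have [z ->] := cqclass_surj x => z0.
apply/qclass_inj0/asboolP/closure_rnormP => e e0.
have e20 : 0 < e / 2 by rewrite divr_gt0.
have [_ [w /= wz <-] we] : exists2 r, E (cqclass z) r & r < e / 2.
  by apply: inf_lt; rewrite // [inf _]z0.
have /asboolP/closure_rnormP/(_ _ e20)[y Sy wy] : z - w \in cspan.
  exact/(qclass_eq cspan)/esym.
exists y => //; rewrite -(subrK w z) addrAC; apply: (le_lt_trans (ler_rnormD _ _)).
by rewrite (splitr e) ltrD.
Qed.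

HB.instance Definition _ :=
  Lmodule_isNormed.Build R[i] cquot ler_cqnormD cqnormZ cqnorm0_eq0.

End ClosedSpan.

(* The algebraic tensor product: free module on P * Q modulo the bilinearity
   relations. *)
Section AlgebraicTensor.
Variables (F : nzRingType) (P Q : lmodType F).

Notation free := {freeg (P * Q) / F}.

Definition free_rel : set free :=
  [set v | (exists p p' q, v = << (p + p', q) >> - << (p, q) >> - << (p', q) >>)
        \/ (exists p q q', v = << (p, q + q') >> - << (p, q) >> - << (p, q') >>)
        \/ (exists a p q, v = << (a *: p, q) >> - a *: << (p, q) >>)
        \/ (exists a p q, v = << (p, a *: q) >> - a *: << (p, q) >>)].

Definition tens : Type := quotmod (lspan free_rel).
HB.instance Definition _ := GRing.Lmodule.on tens.

Definition tensor (p : P) (q : Q) : tens := qclass (lspan free_rel) << (p, q) >>.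

Lemma tensorDl p p' q : tensor (p + p') q = tensor p q + tensor p' q.
Proof.
rewrite /tensor -[RHS]qclassD; apply/qclass_eq/sub_lspan; left.
by exists p, p', q; rewrite opprD addrA.
Qed.

Lemma tensorDr p q q' : tensor p (q + q') = tensor p q + tensor p q'.
Proof.
rewrite /tensor -[RHS]qclassD; apply/qclass_eq/sub_lspan; right; left.
by exists p, q, q'; rewrite opprD addrA.
Qed.

Lemma tensorZl a p q : tensor (a *: p) q = a *: tensor p q.
Proof.
rewrite /tensor -[RHS]qclassZ; apply/qclass_eq/sub_lspan.
by do 2!right; left; exists a, p, q.
Qed.

Lemma tensorZr a p q : tensor p (a *: q) = a *: tensor p q.
Proof.
rewrite /tensor -[RHS]qclassZ; apply/qclass_eq/sub_lspan.
by do 3!right; exists a, p, q.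
Qed.

Lemma tens_sum (u : tens) :
  exists s : seq (P * Q), u = \sum_(x <- s) tensor x.1 x.2.
Proof.
rewrite -[u]qreprK; set v := qrepr u; rewrite -[v]freeg_sumE.
exists [seq (coeff z v *: z.1, z.2) | z <- dom v].
rewrite [RHS]big_map.
transitivity (\sum_(z <- dom v) (qclass (lspan free_rel) << coeff z v *g z >> : tens)).
  exact: (linear_sum (qclass (lspan free_rel))).
apply: eq_bigr => -[p q] _ /=; rewrite tensorZl /tensor.
rewrite -[RHS](qclassZ (lspan free_rel)).
by congr qclass; apply/eqP/freeg_eqP => y; rewrite coeffZ !coeffU mul1r.
Qed.

End AlgebraicTensor.

Section ProjectiveNorm.
Variables (R : realType) (P Q : normedModType R[i]).

Definition tensor_sums (u : tens P Q) : set R :=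
  [set r | exists2 s : seq (P * Q), u = \sum_(x <- s) tensor x.1 x.2
                                 & r = \sum_(x <- s) rnorm x.1 * rnorm x.2].

Definition projnorm (u : tens P Q) : R := inf (tensor_sums u).

Let E_neq0 u : tensor_sums u !=set0.
Proof.
by have [s us] := tens_sum u; exists (\sum_(x <- s) rnorm x.1 * rnorm x.2), s.
Qed.

Let E_lb u : lbound (tensor_sums u) 0.
Proof. by move=> _ [s _ ->]; apply: sumr_ge0 => x _; rewrite mulr_ge0 ?rnorm_ge0. Qed.

Lemma projnorm_ge0 u : 0 <= projnorm u.
Proof. by apply: lb_le_inf; [exact: E_neq0|exact: E_lb]. Qed.

Lemma projnorm_le (s : seq (P * Q)) :
  projnorm (\sum_(x <- s) tensor x.1 x.2) <= \sum_(x <- s) rnorm x.1 * rnorm x.2.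
Proof. by apply: ge_inf; [exists 0; exact: E_lb|exists s]. Qed.

Fact projnormD u v : projnorm (u + v) <= projnorm u + projnorm v.
Proof.
rewrite -lerBlDr; apply: lb_le_inf; [exact: E_neq0|] => _ [s us ->].
rewrite lerBlDr -lerBlDl; apply: lb_le_inf; [exact: E_neq0|] => _ [t vt ->].
by rewrite lerBlDl us vt -!big_cat; exact: projnorm_le.
Qed.

Fact projnormZ a u : projnorm (a *: u) = rnorm a * projnorm u.
Proof.
apply: homogeneous_of_le => {a u} [u|a u]; first exact: projnorm_ge0.
have [->|a0] := eqVneq a 0.
  rewrite scale0r rnorm0 mul0r.
  by have := projnorm_le [::]; rewrite !big_nil.
have a_gt0 : 0 < rnorm a.
  by rewrite lt_def rnorm_ge0 andbT; apply: contra_neq a0; exact: rnorm0_eq0.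
rewrite -ler_pdivrMl//; apply: lb_le_inf; [exact: E_neq0|] => _ [s us ->].
rewrite ler_pdivrMl// us.
have := projnorm_le [seq (a *: x.1, x.2) | x <- s].
rewrite !big_map /= mulr_sumr scaler_sumr.
under eq_bigr do rewrite tensorZl.
by under [leRHS]eq_bigr do rewrite rnormZ -mulrA.
Qed.

Definition projnorm_seminorm : seminorm (tens P Q) :=
  Seminorm projnormD projnormZ.

(* The projective tensor product, i.e. the completion of the algebraic tensor
   product for the projective norm. *)
Definition projtens : Type := completion projnorm_seminorm.
HB.instance Definition _ := CompleteNormedModule.on projtens.

Definition ptensor (p : P) (q : Q) : projtens := cinj projnorm_seminorm (tensor p q).

End ProjectiveNorm.

Section BoundedMaps.
Variable R : realType.

Definition bounded_linear (V W : normedModType R[i]) (f : V -> W) : Prop :=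
  linear f /\ exists M : R, forall x, rnorm (f x) <= M * rnorm x.

Definition bounded_bilinear (U V W : normedModType R[i]) (f : U -> V -> W) : Prop :=
  [/\ forall y, linear (f^~ y), forall x, linear (f x)
    & exists M : R, forall x y, rnorm (f x y) <= M * rnorm x * rnorm y].

Definition topological_iso (V W : normedModType R[i]) (f : V -> W) : Prop :=
  linear f /\
  exists g : W -> V, [/\ cancel f g, cancel g f, continuous f & continuous g].

Variables V W : normedModType R[i].

Lemma bounded_linear0 : @bounded_linear V W 0.
Proof.
split; first by move=> a x y; rewrite /= scaler0 addr0.
by exists 0 => x; rewrite mul0r /rnorm normr0.
Qed.

Lemma bounded_linearZD a (f g : V -> W) :
  bounded_linear f -> bounded_linear g -> bounded_linear (a *: f + g).
Proof.
move=> [lf [M fM]] [lg [N gN]]; split.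
  move=> b x y; rewrite -![(a *: f + g) _]/(a *: f _ + g _) lf lg.
  by rewrite !scalerDr !scalerA [a * b]mulrC addrACA.
exists (rnorm a * M + N) => x; apply: (le_trans (ler_rnormD _ _)).
by rewrite mulrDl rnormZ -mulrA lerD// ler_wpM2l ?rnorm_ge0.
Qed.

Fact bounded_linear_submod : submod_closed (fun f : V -> W => `[< bounded_linear f >]).
Proof.
split; first exact/asboolP/bounded_linear0.
by move=> a f g /asboolP hf /asboolP hg; exact/asboolP/bounded_linearZD.
Qed.

End BoundedMaps.

Section LinearMap.
Variables (F : pzRingType) (V W : lmodType F) (f : V -> W) (lf : linear f).

Lemma linear_map0 : f 0 = 0.
Proof. by have := lf (-1) 0 0; rewrite scaler0 addr0 scaleN1r addNr. Qed.

Lemma linear_mapZ a x : f (a *: x) = a *: f x.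
Proof. by have := lf a x 0; rewrite linear_map0 !addr0. Qed.

Lemma linear_mapD x y : f (x + y) = f x + f y.
Proof. by have := lf 1 x y; rewrite !scale1r. Qed.

End LinearMap.

Section Dual.
Variables (R : realType) (V : normedModType R[i]).

Definition dual_space : subspace (V -> R[i]^o) :=
  Subspace (@bounded_linear_submod R V R[i]^o).

Definition topdual : Type := submod dual_space.
HB.instance Definition _ := GRing.Lmodule.on topdual.

Definition dual_fun (f : topdual) : V -> R[i]^o := sval f.
Coercion dual_fun : topdual >-> Funclass.

Lemma dualP (f : topdual) : bounded_linear f.
Proof. by apply/asboolP; exact: (svalP f). Qed.

Lemma dual_ext (f g : topdual) : f =1 g -> f = g.
Proof. by move=> fg; apply/val_inj/funext. Qed.

Definition mk_dual (f : V -> R[i]^o) (fP : bounded_linear f) : topdual :=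
  exist (fun f => f \in dual_space) f (asboolT fP).

Lemma dualDE (f g : topdual) x : dual_fun (f + g) x = f x + g x.
Proof. by []. Qed.

Lemma dualZE a (f : topdual) x : dual_fun (a *: f) x = a *: f x.
Proof. by []. Qed.

Lemma dualBE (f g : topdual) x : dual_fun (f - g) x = f x - g x.
Proof. by []. Qed.

Lemma dual0E x : dual_fun 0 x = 0.
Proof. by []. Qed.

(* Operator norm on the dual; a map into topdual V is bounded for this norm. *)
Definition dnormR (f : topdual) : R :=
  sup [set rnorm (f x) | x in [set x | rnorm x <= 1]].

Let E (f : topdual) := [set rnorm (f x) | x in [set x | rnorm x <= 1]].

Let E_ub f : has_ubound (E f).
Proof.
have [_ [M fM]] := dualP f; exists `|M| => _ [x /= x1 <-].
apply: (le_trans (fM x)); apply: le_trans (ler_norm _) _.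
by rewrite normrM (ger0_norm (rnorm_ge0 x)) ler_piMr.
Qed.

Let E_neq0 f : E f !=set0.
Proof. by exists (rnorm (f 0)), 0 => //=; rewrite rnorm0. Qed.

Lemma dnormR_ge (f : topdual) x : rnorm x <= 1 -> rnorm (f x) <= dnormR f.
Proof. by move=> x1; apply: ub_le_sup; [exact: E_ub|exists x]. Qed.

Lemma dnormR_ge0 f : 0 <= dnormR f.
Proof.
by apply: le_trans (rnorm_ge0 (f 0)) (dnormR_ge _ _); rewrite rnorm0.
Qed.

Lemma dnormR_le (f : topdual) M : (forall x, rnorm x <= 1 -> rnorm (f x) <= M) ->
  dnormR f <= M.
Proof. by move=> fM; apply: ge_sup; [exact: E_neq0|move=> _ [x /= x1 <-]; exact: fM]. Qed.

Lemma dnormRP (f : topdual) x : rnorm (f x) <= dnormR f * rnorm x.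
Proof.
have [lf _] := dualP f.
have [->|x0] := eqVneq x 0; first by rewrite (linear_map0 lf) !rnorm0 mulr0.
have xgt0 : 0 < rnorm x.
  by rewrite lt_def rnorm_ge0 andbT; apply: contra_neq x0; exact: rnorm0_eq0.
have xV : rnorm ((rnorm x)^-1%:C : R[i]) = (rnorm x)^-1.
  apply: (@complexI R); rewrite rnormE ger0_norm//.
  by rewrite lecR invr_ge0 rnorm_ge0.
have : rnorm (f ((rnorm x)^-1%:C *: x)) <= dnormR f.
  by apply: dnormR_ge; rewrite rnormZ xV mulVf// gt_eqF.
by rewrite (linear_mapZ lf) rnormZ xV mulrC ler_pdivrMr.
Qed.

Definition dnorm (f : topdual) : R[i] := (dnormR f)%:C.

Fact ler_dnormD f g : dnorm (f + g) <= dnorm f + dnorm g.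
Proof.
rewrite -rmorphD/= lecR; apply: dnormR_le => x x1; rewrite dualDE.
by apply: (le_trans (ler_rnormD _ _)); rewrite lerD// dnormR_ge.
Qed.

Fact dnormZ (a : R[i]) f : dnorm (a *: f) = `|a| * dnorm f.
Proof.
rewrite -rnormE -rmorphM/=; congr (_%:C); apply: homogeneous_of_le => {a f}.
  exact: dnormR_ge0.
move=> a f; apply: dnormR_le => x x1; rewrite dualZE rnormZ.
by rewrite ler_wpM2l ?rnorm_ge0 ?dnormR_ge.
Qed.

Fact dnorm0_eq0 f : dnorm f = 0 -> f = 0.
Proof.
move=> /(@complexI R) f0; apply: dual_ext => x; rewrite dual0E.
apply: rnorm0_eq0; apply/eqP; rewrite eq_le rnorm_ge0 andbT.
by rewrite (le_trans (dnormRP f x))// f0 mul0r.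
Qed.

HB.instance Definition _ :=
  Lmodule_isNormed.Build R[i] topdual ler_dnormD dnormZ dnorm0_eq0.

End Dual.

(* Banach algebras need not be unital, hence the separate multiplication bmul. *)
HB.mixin Record isBanachAlgebra (R : realType) (A : Type)
    of CompleteNormedModule R[i] A := {
  bmul : A -> A -> A;
  bmulA : associative bmul;
  bmul_linearl : forall b, linear (bmul^~ b);
  bmul_linearr : forall a, linear (bmul a);
  ler_normbM : forall a b, `|bmul a b| <= `|a| * `|b|
}.

#[short(type="banachAlgType")]
HB.structure Definition BanachAlgebra (R : realType) :=
  {A of CompleteNormedModule R[i] A & isBanachAlgebra R A}.

Section Restrict.
Variables (F : pzRingType) (V : lmodType F) (W U : subspace V).

Fact restrict_submod : submod_closed (fun x : submod W => sval x \in U).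
Proof. by split => [|a x y]; [exact: (subspaceP U).1|exact: (subspaceP U).2]. Qed.
Definition subrestrict : subspace (submod W) := Subspace restrict_submod.

End Restrict.

Section Modules.
Variable R : realType.

(* Module actions are bounded bilinear maps, not necessarily contractive. *)
Record leftBanachModule (A : banachAlgType R) := LeftBanachModule {
  lmod_sort :> completeNormedModType R[i];
  lact : A -> lmod_sort -> lmod_sort;
  lact_bounded : bounded_bilinear lact;
  lactA : forall a b x, lact (bmul a b) x = lact a (lact b x)
}.

Record rightBanachModule (A : banachAlgType R) := RightBanachModule {
  rmod_sort :> completeNormedModType R[i];
  ract : rmod_sort -> A -> rmod_sort;
  ract_bounded : bounded_bilinear ract;
  ractA : forall x a b, ract x (bmul a b) = ract (ract x a) b
}.

Record banachBimodule (A B : banachAlgType R) := BanachBimodule {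
  bimod_sort :> completeNormedModType R[i];
  blact : A -> bimod_sort -> bimod_sort;
  bract : bimod_sort -> B -> bimod_sort;
  blact_bounded : bounded_bilinear blact;
  bract_bounded : bounded_bilinear bract;
  blactA : forall a a' x, blact (bmul a a') x = blact a (blact a' x);
  bractA : forall x b b', bract x (bmul b b') = bract (bract x b) b';
  blractA : forall a x b, bract (blact a x) b = blact a (bract x b)
}.

Definition bimod_left (A B : banachAlgType R) (P : banachBimodule A B) :
  leftBanachModule A := LeftBanachModule (blact_bounded P) (@blactA A B P).

Definition bimod_right (A B : banachAlgType R) (P : banachBimodule A B) :
  rightBanachModule B := RightBanachModule (bract_bounded P) (@bractA A B P).

Fact bmul_bounded (A : banachAlgType R) : bounded_bilinear (@bmul R A).
Proof.
split; [exact: bmul_linearl|exact: bmul_linearr|].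
exists 1 => a b; rewrite mul1r -lecR rmorphM/= !rnormE; exact: ler_normbM.
Qed.

Definition regular_left (A : banachAlgType R) : leftBanachModule A :=
  LeftBanachModule (bmul_bounded A) (fun a b x => esym (bmulA a b x)).

Definition regular_right (A : banachAlgType R) : rightBanachModule A :=
  RightBanachModule (bmul_bounded A) (@bmulA R A).

End Modules.

Section BalancedTensor.
Variables (R : realType) (A : banachAlgType R).
Variables (P : rightBanachModule A) (Q : leftBanachModule A).

Definition balancing : set (projtens P Q) :=
  [set t | exists p a q, t = ptensor (ract p a) q - ptensor p (lact a q)].

Definition baltens : Type := cquot balancing.
HB.instance Definition _ := NormedModule.on baltens.

Definition baltensor (p : P) (q : Q) : baltens := cqclass balancing (ptensor p q).

(* T is the bounded linear map induced by the balanced map f; it is unique since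
   the elementary tensors span a dense subspace. *)
Definition implements (Z : normedModType R[i]) (T : baltens -> Z) (f : P -> Q -> Z) : Prop :=
  bounded_linear T /\ forall p q, T (baltensor p q) = f p q.

Definition implements_iso (Z : normedModType R[i]) (f : P -> Q -> Z) : Prop :=
  exists T : baltens -> Z, implements T f /\ topological_iso T.

End BalancedTensor.

Definition self_induced (R : realType) (A : banachAlgType R) : Prop :=
  @implements_iso R A (regular_right A) (regular_left A) A (@bmul R A).

(* The fields mc_pq_lact, mc_pq_ract, mc_qp_lact and mc_qp_ract say that the
   implemented maps are bimodule homomorphisms: the actions on P (x) Q are
   a . (p (x) q) = (a . p) (x) q and (p (x) q) . a = p (x) (q . a). *)
Record moritaContext (R : realType) (A B : banachAlgType R) := MoritaContext {
  mcP : banachBimodule A B;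
  mcQ : banachBimodule B A;
  mc_pq : mcP -> mcQ -> A;
  mc_qp : mcQ -> mcP -> B;
  mc_pq_bounded : bounded_bilinear mc_pq;
  mc_qp_bounded : bounded_bilinear mc_qp;
  mc_pq_balanced : forall p b q, mc_pq (bract p b) q = mc_pq p (blact b q);
  mc_qp_balanced : forall q a p, mc_qp (bract q a) p = mc_qp q (blact a p);
  mc_pq_lact : forall a p q, mc_pq (blact a p) q = bmul a (mc_pq p q);
  mc_pq_ract : forall p q a, mc_pq p (bract q a) = bmul (mc_pq p q) a;
  mc_qp_lact : forall b q p, mc_qp (blact b q) p = bmul b (mc_qp q p);
  mc_qp_ract : forall q p b, mc_qp q (bract p b) = bmul (mc_qp q p) b;
  mc_pqp : forall p q p', blact (mc_pq p q) p' = bract p (mc_qp q p');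
  mc_qpq : forall q p q', blact (mc_qp q p) q' = bract q (mc_pq p q')
}.

Arguments mc_pq {R A B} m _ _.
Arguments mc_qp {R A B} m _ _.

Definition full_context (R : realType) (A B : banachAlgType R)
    (M : moritaContext A B) : Prop :=
  @implements_iso R B (bimod_right (mcP M)) (bimod_left (mcQ M)) A (mc_pq M) /\
  @implements_iso R A (bimod_right (mcQ M)) (bimod_left (mcP M)) B (mc_qp M).

Section DualBimodule.
Variables (R : realType) (A : banachAlgType R).

Fact dual_lact_bounded (a : A) (f : topdual A) :
  bounded_linear (fun x : A => f (bmul x a)).
Proof.
have [lf [M fM]] := dualP f; have [lm _ [N mN]] := bmul_bounded A; split.
  by move=> c x y; rewrite lm lf.
exists (`|M| * (`|N| * rnorm a)) => x; apply: (le_trans (fM _)).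
apply: (@le_trans _ _ (`|M| * rnorm (bmul x a))).
  by rewrite ler_wpM2r ?rnorm_ge0 ?ler_norm.
rewrite -!mulrA ler_wpM2l//; apply: (le_trans (mN _ _)).
by rewrite mulrAC -mulrA ler_wpM2r ?ler_norm// mulr_ge0 ?rnorm_ge0.
Qed.

Fact dual_ract_bounded (f : topdual A) (a : A) :
  bounded_linear (fun x : A => f (bmul a x)).
Proof.
have [lf [M fM]] := dualP f; have [_ lm [N mN]] := bmul_bounded A; split.
  by move=> c x y; rewrite lm lf.
exists (`|M| * (`|N| * rnorm a)) => x; apply: (le_trans (fM _)).
apply: (@le_trans _ _ (`|M| * rnorm (bmul a x))).
  by rewrite ler_wpM2r ?rnorm_ge0 ?ler_norm.
rewrite -!mulrA ler_wpM2l//; apply: (le_trans (mN _ _)).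
by rewrite -mulrA ler_wpM2r ?ler_norm// mulr_ge0 ?rnorm_ge0.
Qed.

Definition dual_lact (a : A) (f : topdual A) : topdual A := mk_dual (dual_lact_bounded a f).
Definition dual_ract (f : topdual A) (a : A) : topdual A := mk_dual (dual_ract_bounded f a).

Lemma dual_lactE a f x : dual_lact a f x = f (bmul x a).
Proof. by []. Qed.

Lemma dual_ractE f a x : dual_ract f a x = f (bmul a x).
Proof. by []. Qed.

Let dE := (dualBE, dualDE, dualZE, dual_lactE, dual_ractE).

Definition derivation (D : A -> topdual A) : Prop :=
  bounded_linear D /\
  forall a b, D (bmul a b) = dual_lact a (D b) + dual_ract (D a) b.

Definition inner_derivation (D : A -> topdual A) : Prop :=
  derivation D /\ exists f, forall a, D a = dual_lact a f - dual_ract f a.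

Lemma derivation0 : derivation 0.
Proof.
split; first exact: bounded_linear0.
by move=> a b; apply: dual_ext => x; rewrite dualDE /= addr0.
Qed.

Lemma derivationZD c D E : derivation D -> derivation E -> derivation (c *: D + E).
Proof.
move=> [bD dD] [bE dE']; split.
  exact: bounded_linearZD.
move=> a b; apply: dual_ext => x.
rewrite -![(c *: D + E) _]/(c *: D _ + E _) dD dE' !dE.
by rewrite scalerDr addrACA.
Qed.

Fact B1_submod : submod_closed (fun D : A -> topdual A => `[< inner_derivation D >]).
Proof.
split.
  apply/asboolP; split; first exact: derivation0.
  by exists 0 => a; apply: dual_ext => x; rewrite dualBE /= subr0.
move=> c D E /asboolP[dD [f Df]] /asboolP[dE' [g Eg]]; apply/asboolP.
split; first exact: derivationZD.
exists (c *: f + g) => a; apply: dual_ext => x.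
rewrite -[(c *: D + E) _]/(c *: D _ + E _) Df Eg !dE.
by rewrite scalerBr opprD addrACA.
Qed.

Definition B1 : subspace (A -> topdual A) := Subspace B1_submod.

End DualBimodule.

(* For a Morita context M, H1M (mc_pq M) is H^1_M(A, A^* ), and H1M (mc_qp M),
   where A, B and P, Q are exchanged, is H^1_M(B, B^* ). *)
Section MoritaCohomology.
Variables (R : realType) (A B : banachAlgType R).
Variables (P : banachBimodule A B) (Q : banachBimodule B A) (pq : P -> Q -> A).

Definition morita_derivation (D : A -> topdual A) : Prop :=
  derivation D /\
  exists psi : P -> Q -> R[i]^o, bounded_bilinear psi /\
    forall p q a, D a (pq p q) = psi (blact a p) q - psi p (bract q a).

Fact Z1M_submod : submod_closed (fun D : A -> topdual A => `[< morita_derivation D >]).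
Proof.
split.
  apply/asboolP; split; first exact: derivation0.
  exists (fun _ _ => 0); split=> [|p q a]; last by rewrite /= subrr.
  split; [by move=> y c x x'; rewrite /= scaler0 addr0..|].
  by exists 0 => x y; rewrite !mul0r rnorm0.
move=> c D E /asboolP[dD [f [bf Df]]] /asboolP[dE [g [bg Eg]]]; apply/asboolP.
split; first exact: derivationZD.
exists (fun p q => c *: f p q + g p q); split; last first.
  move=> p q a; rewrite -[(c *: D + E) _]/(c *: D _ + E _) !(dualDE, dualZE).
  by rewrite Df Eg scalerBr opprD addrACA.
case: bf => f1 f2 [M fM]; case: bg => g1 g2 [N gN]; split.
- move=> y b x x'; rewrite f1 g1 !scalerDr !scalerA [c * b]mulrC.
  by rewrite addrACA.
- move=> x b y y'; rewrite f2 g2 !scalerDr !scalerA [c * b]mulrC.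
  by rewrite addrACA.
exists (rnorm c * M + N) => x y; apply: (le_trans (ler_rnormD _ _)).
by rewrite !mulrDl rnormZ -!mulrA lerD ?ler_wpM2l ?rnorm_ge0// ?mulrA.
Qed.

Definition Z1M : subspace (A -> topdual A) := Subspace Z1M_submod.

(* subrestrict Z1M (B1 A) is B1 A viewed inside Z1M. *)
Definition H1M : Type := quotmod (subrestrict Z1M (B1 A)).
HB.instance Definition _ := GRing.Lmodule.on H1M.

(* When pq implements a bimodule homomorphism, B1 is contained in Z1M, so that
   H1M is the quotient Z1M / B1. *)
Lemma B1_sub_Z1M :
  bounded_bilinear pq ->
  (forall a p q, pq (blact a p) q = bmul a (pq p q)) ->
  (forall p q a, pq p (bract q a) = bmul (pq p q) a) ->
  forall D, D \in B1 A -> D \in Z1M.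
Proof.
move=> [l1 l2 [N hN]] pql pqr D /asboolP[dD [f Df]]; apply/asboolP; split => //.
have [lf [C fC]] := dualP f.
exists (fun p q => (-1) *: f (pq p q)); split; last first.
  move=> p q a; rewrite Df dualBE /= pql pqr.
  by rewrite !scaleN1r opprK addrC.
split.
- move=> q c p p'; rewrite l1 lf scalerDr !scalerA.
  by rewrite (mulrC (-1)).
- move=> p c q q'; rewrite l2 lf scalerDr !scalerA.
  by rewrite (mulrC (-1)).
exists (`|C| * `|N|) => p q; rewrite scaleN1r rnormN; apply: (le_trans (fC _)).
apply: (@le_trans _ _ (`|C| * rnorm (pq p q))).
  by rewrite ler_wpM2r ?rnorm_ge0 ?ler_norm.
rewrite -!mulrA ler_wpM2l//; apply: (le_trans (hN _ _)).
by rewrite -mulrA ler_wpM2r ?ler_norm// mulr_ge0 ?rnorm_ge0.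
Qed.

End MoritaCohomology.

(* Main.v *)
(* Given a derivation D and a form psi with
   <{p,q}, D a> = psi(ap,q) - psi(p,qa), the expression psi(pb,q) - psi(p,bq) is
   A-balanced in (q,p), because D a takes the same value at {pb,q} = {p,bq};
   since [.,.] implements an isomorphism of Q (x)_A P onto B, it equals
   <[q,p], E b> for a unique E b in B^*, and E is a derivation implemented by
   -psi. Call D and E associated. This relation is linear and symmetric under
   exchanging A and B. If D is inner, given by f, then psi(p,q) + f({p,q}) is
   A-balanced, hence of the form h([q,p]), and E is inner, given by h. So the
   relation descends to a linear bijection of the quotients. *)
Require Import Defs.
From HB Require Import structures.
From mathcomp Require Import all_boot all_order all_algebra.
From mathcomp Require Import freeg complex ring.
From mathcomp Require Import all_classical all_reals topology normedtype sequences.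

Import GRing.Theory.
Local Open Scope ring_scope.
Import Order.TTheory Num.Theory numFieldNormedType.Exports.
Local Open Scope classical_set_scope.
Local Open Scope complex_scope.
Set Implicit Arguments.
Unset Strict Implicit.
Unset Printing Implicit Defensive.

(** * Linear maps out of the algebraic tensor product *)

Section AlgebraicLift.
Variables (F : nzRingType) (P Q W : lmodType F) (f : P -> Q -> W).
Hypotheses (fl : forall q, linear (f^~ q)) (fr : forall p, linear (f p)).

Let lift := fglift (fun x : P * Q => f x.1 x.2).

Let liftB : {morph lift : u v / u - v}.
Proof. exact: lift_is_additive. Qed.

Let lift0 : lift 0 = 0.
Proof. by rewrite -(subrr 0) liftB subrr. Qed.

Let liftD : {morph lift : u v / u + v}.
Proof.
by move=> u v; rewrite -{1}[v]opprK liftB -[- v]sub0r liftB lift0 sub0r opprK.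
Qed.

Let liftZ c u : lift (c *: u) = c *: lift u.
Proof.
rewrite -[u]freeg_sumE scaler_sumr !(big_morph lift liftD lift0) scaler_sumr.
apply: eq_bigr => z _.
have -> : c *: << coeff z u *g z >> = << (c * coeff z u) *g z >>.
  by apply/eqP/freeg_eqP => y; rewrite coeffZ !coeffU mulrA.
by rewrite /lift !liftU scalerA.
Qed.

Fact lift_ker_submod : submod_closed (fun u => lift u == 0).
Proof.
split; first by rewrite /in_mem /= lift0.
by move=> a u v /eqP hu /eqP hv; apply/eqP; rewrite liftD liftZ hu hv scaler0 addr0.
Qed.

(** The linear extension of [f] to the free module kills the four kinds of bilinearity relations,
    hence their span, so evaluating it on chosen representatives is well defined. *)
Lemma tens_lift : exists L : tens P Q -> W,
  linear L /\ forall p q, L (tensor p q) = f p q.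
Proof.
have kill : forall u, u \in lspan (@free_rel F P Q) -> lift u = 0.
  move=> u /(lspan_ind (W := Subspace lift_ker_submod)) ku; apply/eqP/ku => {ku}.
  move=> {}u hu; apply/eqP; rewrite -/(lift u).
  case: hu => [[p [p' [q ->]]]|[[p [q [q' ->]]]|[[a [p [q ->]]]|[a [p [q ->]]]]]];
    rewrite !liftB ?liftZ /lift !liftU !scale1r /=.
  - by rewrite (linear_mapD (fl q)) addrAC addrK subrr.
  - by rewrite (linear_mapD (fr p)) addrAC addrK subrr.
  - by rewrite (linear_mapZ (fl q)) subrr.
  - by rewrite (linear_mapZ (fr p)) subrr.
have liftE u : lift (qrepr (qclass (lspan (@free_rel F P Q)) u)) = lift u.
  apply/subr0_eq; rewrite -liftB; apply/kill/(qclass_eq (lspan _)).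
  exact: qreprK.
exists (fun x => lift (qrepr x)); split.
  move=> a x y; rewrite -{1}[x]qreprK -{1}[y]qreprK.
  by rewrite -[_ *: _ + _](linearP (qclass _)) liftE liftD liftZ.
by move=> p q; rewrite liftE /lift liftU scale1r.
Qed.

End AlgebraicLift.

(** * Completeness of the complex numbers via real and imaginary parts *)

Section ComplexValues.
Variable R : realType.

Lemma rnorm_ge_Re (z : R[i]^o) : `|complex.Re z| <= rnorm z.
Proof.
case: z => a b; rewrite /rnorm normc_def /=.
by rewrite -sqrtr_sqr ler_wsqrtr// lerDl sqr_ge0.
Qed.

Lemma rnorm_ge_Im (z : R[i]^o) : `|complex.Im z| <= rnorm z.
Proof.
case: z => a b; rewrite /rnorm normc_def /=.
by rewrite -sqrtr_sqr ler_wsqrtr// lerDr sqr_ge0.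
Qed.

Lemma rnorm_le_ReIm (z : R[i]^o) :
  rnorm z <= `|complex.Re z| + `|complex.Im z|.
Proof.
case: z => a b; rewrite /rnorm normc_def /=.
rewrite -(@ler_pXn2r _ 2) ?nnegrE ?sqrtr_ge0 ?addr_ge0// sqr_sqrtr.
  by rewrite sqrrD !real_normK ?num_real// addrAC lerDl mulrn_wge0// mulr_ge0.
by rewrite addr_ge0 ?sqr_ge0.
Qed.

Let R_cauchy (w : nat -> R) :
  (forall e, 0 < e -> exists N, forall m n, (N <= m)%N -> (N <= n)%N ->
     `|w m - w n| < e) -> cvgn w.
Proof.
move=> h; apply: R_complete; apply: cauchy_exP => e e0.
have [N hN] := h e e0; exists (w N); exists N => // n /= Nn.
by rewrite -ball_normE /=; exact: hN.
Qed.

Let dist_cvg0 (w : nat -> R) c : w @ \oo --> c ->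
  (fun n => `|w n - c|) @ \oo --> (0 : R).
Proof.
move=> wc; rewrite -(@normr0 R R) -(subrr c).
by apply: cvg_norm; apply: cvgB => //; exact: cvg_cst.
Qed.

Lemma complex_cauchy_cvg (w : nat -> R[i]^o) :
  (forall e, 0 < e -> exists N, forall m n, (N <= m)%N -> (N <= n)%N ->
     rnorm (w m - w n) < e) ->
  exists y, (fun n => rnorm (w n - y)) @ \oo --> (0 : R).
Proof.
move=> h.
have cRe : cvgn (fun n => complex.Re (w n)).
  apply: R_cauchy => e /h[N hN]; exists N => m n Nm Nn.
  apply: le_lt_trans (hN m n Nm Nn).
  by have := rnorm_ge_Re (w m - w n); case: (w m) (w n) => ? ? [].
have cIm : cvgn (fun n => complex.Im (w n)).
  apply: R_cauchy => e /h[N hN]; exists N => m n Nm Nn.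
  apply: le_lt_trans (hN m n Nm Nn).
  by have := rnorm_ge_Im (w m - w n); case: (w m) (w n) => ? ? [].
move: cRe cIm => /cvg_ex[a ha] /cvg_ex[b hb].
exists (a +i* b).
apply: (@squeeze_cvgr _ _ _ _ (cst 0)
  (fun n => `|complex.Re (w n) - a| + `|complex.Im (w n) - b|)).
- apply: nearW => n; rewrite rnorm_ge0 /=.
  by have := rnorm_le_ReIm (w n - (a +i* b)); case: (w n).
- exact: cvg_cst.
- by rewrite -[X in _ --> X](addr0 0); apply: cvgD; exact: dist_cvg0.
Qed.

End ComplexValues.

(** * Extension of bounded functionals to the completion *)

Section CompletionExtension.
Variables (R : realType) (V : lmodType R[i]) (s : seminorm V).
Variables (L : V -> R[i]^o) (M : R).
Hypotheses (M0 : 0 < M) (Ll : linear L) (Ls : forall v, rnorm (L v) <= M * s v).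

Let B x y : L (x - y) = L x - L y.
Proof. by rewrite addrC -scaleN1r Ll scaleN1r addrC. Qed.

(** The graph of the extension on Cauchy sequences, kept as a relation until existence and
    uniqueness of the limit are known. *)
Let limit (u : cseq s) (y : R[i]^o) :=
  (fun n => rnorm (L (seq_of u n) - y)) @ \oo --> (0 : R).

Let limit_ex u : exists y, limit u y.
Proof.
apply: complex_cauchy_cvg => e e0.
have [N hN] := seq_ofP u (divr_gt0 e0 M0); exists N => m n Nm Nn.
rewrite -B; apply: le_lt_trans (Ls _) _.
by rewrite mulrC -ltr_pdivlMr//; exact: hN.
Qed.

Let limit_eq u v y z : limit u y -> limit v z -> u - v \in @null_pred R V s -> y = z.
Proof.
move=> hu hv /asboolP huv; apply/subr0_eq/rnorm0_eq0/eqP.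
rewrite eq_le rnorm_ge0 andbT.
(* By the triangle inequality through [L] at the terms of [u] and [v], this null sequence dominates
   the norm of [y - z]. *)
have h0 : (fun n => rnorm (L (seq_of u n) - y) + (rnorm (L (seq_of v n) - z) +
    M * (s \o seq_of (u - v)) n)) @ \oo --> (0 : R).
  rewrite -[X in _ --> X](addr0 0) -[X in _ --> _ + X](addr0 0).
  rewrite -[X in _ --> _ + (_ + X)](mulr0 M).
  by apply: cvgD => //; apply: cvgD => //; exact: cvgMl_tmp.
rewrite -(cvg_lim _ h0)//; apply: limr_ge; first by apply/cvg_ex; exists 0.
apply: nearW => n /=.
apply: le_trans (rnormB_le _ (L (seq_of u n)) _) _.
rewrite rnormB lerD2l; apply: le_trans (rnormB_le _ (L (seq_of v n)) _) _.
by rewrite addrC lerD2l -B; exact: Ls.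
Qed.

Let limitZD a u v y z : limit u y -> limit v z -> limit (a *: u + v) (a *: y + z).
Proof.
move=> hu hv.
apply: (@squeeze_cvgr _ _ _ _ (cst 0)
  (fun n => rnorm a * rnorm (L (seq_of u n) - y) + rnorm (L (seq_of v n) - z))).
- apply: nearW => n; rewrite rnorm_ge0 seq_ofZD Ll /=.
  rewrite -rnormZ; apply: le_trans (ler_rnormD _ _).
  by rewrite scalerBr opprD addrACA.
- exact: cvg_cst.
- rewrite -[X in _ --> X](addr0 0) -[X in _ --> X + _](mulr0 (rnorm a)).
  by apply: cvgD => //; exact: cvgMl_tmp.
Qed.

Lemma completion_extend : exists F : completion s -> R[i]^o,
  [/\ linear F, forall v, F (cinj s v) = L v
    & forall x, rnorm (F x) <= M * rnorm x].
Proof.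
have [F hF] := choice (fun x : completion s => limit_ex (crepr x)).
have FE u y : limit u y -> F (cclass u) = y.
  by move=> hy; apply: limit_eq (hF _) hy _; exact: crepr_null.
exists F; split.
- move=> a x y; rewrite -{1}[x]creprK -{1}[y]creprK -cclassZD.
  by apply: FE; exact: limitZD.
- move=> v; apply: FE; rewrite /limit (_ : (fun _ => _) = cst 0).
    exact: cvg_cst.
  by apply/funext => n; rewrite subrr rnorm0.
- move=> x; rewrite rnorm_completion /cnormR.
  (* Each term bounds the norm of [F x], and the limit is exactly [M] times the norm of [x], so the
     constant does not grow. *)
  have h0 : (fun n => rnorm (L (seq_of (crepr x) n) - F x) +
      M * (s \o seq_of (crepr x)) n) @ \oo --> M * limn (s \o seq_of (crepr x)).
    rewrite -[X in _ --> X]add0r; apply: cvgD; first exact: hF.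
    by apply: cvgMl_tmp; exact: cvg_seminorm.
  rewrite -(cvg_lim _ h0)//; apply: limr_ge.
    by apply/cvg_ex; eexists; exact: h0.
  apply: nearW => n /=; rewrite -{1}[F x]subr0.
  apply: le_trans (rnormB_le _ (L (seq_of (crepr x) n)) _) _.
  by rewrite rnormB subr0 lerD2l; exact: Ls.
Qed.

End CompletionExtension.

(** * Continuous linear maps are bounded *)

Section LinearTheory.
Variable R : realType.

Lemma linear_mapB (V W : lmodType R[i]) (f : V -> W) x y :
  linear f -> f (x - y) = f x - f y.
Proof. by move=> lf; rewrite addrC -scaleN1r lf scaleN1r addrC. Qed.

Lemma rnorm_real (V : normedModType R[i]) (r : R) (x : V) :
  0 <= r -> rnorm (r%:C *: x) = r * rnorm x.
Proof.
move=> r0; rewrite rnormZ; congr (_ * _); apply: (@complexI R).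
by rewrite rnormE ger0_norm// lecR.
Qed.

Lemma continuous_linear_bound (V W : normedModType R[i]) (g : V -> W) :
  linear g -> continuous g ->
  exists2 K : R, 0 < K & forall x, rnorm (g x) <= K * rnorm x.
Proof.
move=> lg cg.
have /cvgrPdist_lt/(_ 1 ltr01) := cg 0.
rewrite (linear_map0 lg) => /nbhs_ballP[e /= e0 eB].
have eE : e = (complex.Re e)%:C by rewrite RRe_real// realE ltW.
move: e0 eB; rewrite eE ltcR; set d := complex.Re e => d0 eB.
(* Rescaling [x] to norm [d / 2] puts it inside the ball of radius [d], where [g] has norm below
   1. *)
exists (2 / d) => [|x]; first by rewrite divr_gt0.
have [->|x0] := eqVneq x 0; first by rewrite (linear_map0 lg) !rnorm0 mulr0.
have xgt0 : 0 < rnorm x.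
  by rewrite lt_def rnorm_ge0 andbT; apply: contra_neq x0; exact: rnorm0_eq0.
have c0 : 0 < d / 2 / rnorm x by rewrite !divr_gt0.
have : rnorm (g ((d / 2 / rnorm x)%:C *: x)) < 1.
  rewrite -rnorm_lt -normrN -sub0r; apply: eB.
  rewrite -ball_normE /= sub0r normrN rnorm_lt (rnorm_real _ (ltW c0)).
  by rewrite divfK ?gt_eqF// ltr_pdivrMr// ltr_pMr// ltrDl.
rewrite (linear_mapZ lg) (rnorm_real _ (ltW c0)) => /ltW.
have -> : 2 / d * rnorm x = (d / 2 / rnorm x)^-1 by rewrite !invf_div mulrC.
by move=> h; rewrite -div1r ler_pdivlMr// mulrC.
Qed.

End LinearTheory.

(** * Descent of functionals to the quotient by a closed span *)

Section QuotientDescent.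
Variables (R : realType) (X : normedModType R[i]) (S : set X).
Variables (F : X -> R[i]^o) (M : R).
Hypotheses (M0 : 0 < M) (lF : linear F).
Hypotheses (FM : forall x, rnorm (F x) <= M * rnorm x).
Hypothesis (FS : forall x, S x -> F x = 0).

Fact ker_submod : submod_closed (fun x => F x == 0).
Proof.
split; first by rewrite /in_mem /= (linear_map0 lF).
by move=> a x y /eqP hx /eqP hy; apply/eqP; rewrite lF hx hy scaler0 addr0.
Qed.

(** The kernel contains the algebraic span, and a point within [e / M] of that span has value at
    most [e]. *)
Lemma ker_cspan x : x \in cspan S -> F x = 0.
Proof.
move=> /asboolP/closure_rnormP xS; apply: rnorm0_eq0; apply/eqP.
rewrite eq_le rnorm_ge0 andbT; apply/ler_addgt0Pl => e e0; rewrite addr0.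
have [y /= yS xy] := xS _ (divr_gt0 e0 M0).
have y0 : F y = 0.
  apply/eqP; apply: (lspan_ind (W := Subspace ker_submod)) yS => z Sz /=.
  exact/eqP/FS.
rewrite -[F x]subr0 -y0 -(linear_mapB _ _ lF); apply: le_trans (FM _) _.
by rewrite mulrC -ler_pdivlMr// ltW.
Qed.

Lemma cquot_descend : exists G : cquot S -> R[i]^o,
  [/\ linear G, forall x, G (cqclass S x) = F x
    & forall x, rnorm (G x) <= M * rnorm x].
Proof.
pose G (x : cquot S) := F (qrepr x).
have GE x : G (cqclass S x) = F x.
  apply/subr0_eq; rewrite -(linear_mapB _ _ lF); apply/ker_cspan/(qclass_eq (cspan S)).
  exact: qreprK.
exists G; split => //.
  move=> a x y; have [u ->] := cqclass_surj x; have [v ->] := cqclass_surj y.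
  by rewrite -cqclass_linear !GE lF.
(* The quotient norm is an infimum over representatives, and each of them obeys the bound for
   [F]. *)
move=> x; rewrite mulrC -ler_pdivrMr//; apply: lb_le_inf.
  by have [u ->] := cqclass_surj x; exists (rnorm u), u.
by move=> _ [z /= <- <-]; rewrite GE ler_pdivrMr// mulrC.
Qed.

End QuotientDescent.

(** * Functionals on the projective tensor product *)

(** The triangle inequality gives the bound for every way of writing [u] as a sum of elementary
    tensors; the infimum keeps it. *)
Lemma projnorm_bound (R : realType) (P Q : normedModType R[i])
    (g : P -> Q -> R[i]^o) (L : tens P Q -> R[i]^o) (M : R) :
  0 < M -> linear L -> (forall p q, L (tensor p q) = g p q) ->
  (forall p q, rnorm (g p q) <= M * rnorm p * rnorm q) ->
  forall u, rnorm (L u) <= M * projnorm_seminorm P Q u.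
Proof.
move=> M0 Ll LE gM u; rewrite mulrC -ler_pdivrMr//; apply: lb_le_inf.
  by have [s us] := tens_sum u; exists (\sum_(x <- s) rnorm x.1 * rnorm x.2), s.
move=> _ [s -> ->]; rewrite ler_pdivrMr// mulrC.
elim: s => [|x s IHs]; first by rewrite !big_nil (linear_map0 Ll) rnorm0 mulr0.
rewrite [in leRHS]big_cons mulrDr mulrA; apply: le_trans (lerD (gM _ _) IHs).
by rewrite big_cons (linear_mapD Ll) LE; exact: ler_rnormD.
Qed.

Lemma projtens_lift (R : realType) (P Q : normedModType R[i])
    (g : P -> Q -> R[i]^o) (M : R) : 0 < M ->
  (forall q, linear (g^~ q)) -> (forall p, linear (g p)) ->
  (forall p q, rnorm (g p q) <= M * rnorm p * rnorm q) ->
  exists F : projtens P Q -> R[i]^o,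
  [/\ linear F, forall p q, F (ptensor p q) = g p q
    & forall x, rnorm (F x) <= M * rnorm x].
Proof.
move=> M0 gl gr gM; have [L [Ll LE]] := tens_lift gl gr.
have [F [lF FE FM]] := completion_extend M0 Ll (projnorm_bound M0 Ll LE gM).
exists F; split; [exact: lF| |exact: FM].
by move=> p q; rewrite -LE; exact: FE.
Qed.

(** Density of the image of [V]; it yields the uniqueness half of the universal property. *)
Lemma completion_eq0 (R : realType) (V : lmodType R[i]) (s : seminorm V)
    (G : completion s -> R[i]^o) :
  bounded_linear G -> (forall v, G (cinj s v) = 0) -> forall x, G x = 0.
Proof.
move=> [lG [M GM]] G0 x; apply: rnorm0_eq0; apply/eqP.
rewrite eq_le rnorm_ge0 andbT; apply/ler_addgt0Pl => e e0; rewrite addr0.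
have M1 : 0 < `|M| + 1 by rewrite ltr_wpDl.
have [v xv] := cinj_dense x (divr_gt0 e0 M1).
rewrite -[G x]subr0 -(G0 v) -(linear_mapB _ _ lG); apply: le_trans (GM _) _.
apply: (@le_trans _ _ ((`|M| + 1) * rnorm (x - cinj _ v))).
  by rewrite ler_wpM2r ?rnorm_ge0// (le_trans (ler_norm M))// lerDl.
by rewrite mulrC -ler_pdivlMr// ltW.
Qed.

Lemma linear_comp_cinj (R : realType) (V : lmodType R[i]) (s : seminorm V)
    (G : completion s -> R[i]^o) : linear G -> linear (fun v => G (cinj s v)).
Proof. by move=> lG a u v; rewrite cinj_linear lG. Qed.

Lemma tens_eq0 (F : nzRingType) (P Q W : lmodType F) (L : tens P Q -> W) :
  linear L -> (forall p q, L (tensor p q) = 0) -> forall v, L v = 0.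
Proof.
move=> lL L0 v; have [s ->] := tens_sum v.
elim: s => [|y s IHs]; first by rewrite big_nil (linear_map0 lL).
by rewrite big_cons (linear_mapD lL) IHs addr0.
Qed.

Lemma projtens_eq0 (R : realType) (P Q : normedModType R[i])
    (G : projtens P Q -> R[i]^o) :
  bounded_linear G -> (forall p q, G (ptensor p q) = 0) -> forall x, G x = 0.
Proof.
move=> bG G0.
have bG' : @bounded_linear R (completion (projnorm_seminorm P Q)) R[i]^o G := bG.
apply: (completion_eq0 bG') => v.
exact: (tens_eq0 (linear_comp_cinj bG'.1)).
Qed.

(** * Universal property of the balanced tensor product *)

Section UniversalProperty.
Variables (R : realType) (A : banachAlgType R).
Variables (P : rightBanachModule A) (Q : leftBanachModule A).

Lemma baltens_lift (g : P -> Q -> R[i]^o) (M : R) : 0 < M ->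
  (forall q, linear (g^~ q)) -> (forall p, linear (g p)) ->
  (forall p q, rnorm (g p q) <= M * rnorm p * rnorm q) ->
  (forall p a q, g (ract p a) q = g p (lact a q)) ->
  exists G : baltens P Q -> R[i]^o,
  [/\ linear G, forall p q, G (baltensor p q) = g p q
    & forall x, rnorm (G x) <= M * rnorm x].
Proof.
move=> M0 gl gr gM gbal.
have [F [lF FE FM]] := projtens_lift M0 gl gr gM.
have FS (t : projtens P Q) : balancing t -> F t = 0.
  case=> p [a [q tE]].
  have FtE : F t = F (ptensor (ract p a) q) - F (ptensor p (lact a q)).
    exact: etrans (congr1 F tE) (linear_mapB _ _ lF).
  by rewrite FtE; apply/eqP; rewrite subr_eq0; apply/eqP; rewrite FE FE.
have [G [lG GE GM]] := cquot_descend M0 lF FM FS.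
exists G; split; [exact: lG| |exact: GM].
by move=> p q; exact: etrans (GE _) (FE _ _).
Qed.

Lemma baltens_eq0 (G : baltens P Q -> R[i]^o) :
  bounded_linear G -> (forall p q, G (baltensor p q) = 0) -> forall x, G x = 0.
Proof.
move=> [lG [M GM]] G0 x; have [z ->] := cqclass_surj x.
apply: (@projtens_eq0 _ _ _ (fun z => G (cqclass (@balancing R A P Q) z))) => //.
split; first by move=> a u v; rewrite cqclass_linear lG.
exists `|M| => u; apply: le_trans (GM _) _.
apply: (@le_trans _ _ (`|M| * rnorm (cqclass (@balancing R A P Q) u))).
  by rewrite ler_wpM2r ?rnorm_ge0 ?ler_norm.
by rewrite ler_wpM2l//; exact: cqnormR_le.
Qed.

Variables (Z : normedModType R[i]) (f : P -> Q -> Z).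
Hypothesis iso_f : implements_iso f.

(** The induced map [T] is onto [Z], and a bounded functional on the balanced tensor product is
    determined by elementary tensors. *)
Lemma topdual_eq (h k : topdual Z) : (forall p q, h (f p q) = k (f p q)) -> h = k.
Proof.
move=> hk; apply: dual_ext => z; apply/subr0_eq; rewrite -dualBE.
have [T [[[lT [N TN]] TE] [_ [g [_ gK _ _]]]]] := iso_f.
pose d : topdual Z := h - k; have [ld [M dM]] := dualP d.
have bT : bounded_linear (fun x => d (T x)).
  split; first by move=> a x y; rewrite lT ld.
  exists (`|M| * N) => x; apply: le_trans (dM _) _.
  apply: (@le_trans _ _ (`|M| * rnorm (T x))).
    by rewrite ler_wpM2r ?rnorm_ge0 ?ler_norm.
  by rewrite -mulrA ler_wpM2l.
rewrite -/d -[z]gK; apply: (baltens_eq0 bT) => p q.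
by rewrite TE /d dualBE hk subrr.
Qed.

(** Composing the functional induced by [g] with the inverse of [T] gives [h]. The constant [K]
    bounds that inverse and is chosen before [g]; this uniformity later makes [E] bounded in [b]. *)
Lemma topdual_lift : exists2 K : R, 0 < K &
  forall (g : P -> Q -> R[i]^o) (M : R), 0 <= M ->
  (forall q, linear (g^~ q)) -> (forall p, linear (g p)) ->
  (forall p q, rnorm (g p q) <= M * rnorm p * rnorm q) ->
  (forall p a q, g (ract p a) q = g p (lact a q)) ->
  exists2 h : topdual Z, forall p q, h (f p q) = g p q & dnormR h <= M * K.
Proof.
have [T [[_ TE] [lT [S [TK SK _ cS]]]]] := iso_f.
have lS : linear S.
  by move=> a x y; apply: (can_inj TK); rewrite lT !SK.
have [K K0 SN] := continuous_linear_bound lS cS.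
(* The case [M = 0] is split off because the lift divides by [M]; it does occur, for instance for
   [b = 0]. *)
exists K => // g M; rewrite le_eqVlt => /predU1P[<- _ _ g0 _|M0 gl gr gM gbal].
  exists 0 => [p q|].
    rewrite dual0E; apply/esym/rnorm0_eq0/eqP.
    by rewrite eq_le rnorm_ge0 andbT; have := g0 p q; rewrite !mul0r.
  by apply: dnormR_le => x _; rewrite dual0E rnorm0 mul0r.
have [G [lG GE GM]] := baltens_lift M0 gl gr gM gbal.
have bh z : rnorm (G (S z)) <= M * K * rnorm z.
  by apply: le_trans (GM _) _; rewrite -mulrA ler_wpM2l// ltW.
have hP : bounded_linear (fun z => G (S z)).
  by split; [move=> a x y; rewrite lS lG|exists (M * K)].
exists (mk_dual hP) => [p q|]; first by rewrite /= -TE TK GE.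
apply: dnormR_le => x x1; apply: le_trans (bh x) _.
by rewrite ler_piMr// mulr_ge0 ?ltW.
Qed.

End UniversalProperty.

(* [r] plays the role of the graph of the isomorphism before passing to the
   quotients, where it need not be single-valued. *)
Lemma quotmod_iso (F : pzRingType) (U V : lmodType F)
    (I : Defs.subspace U) (J : Defs.subspace V) (r : U -> V -> Prop) :
  (forall a x x' y y', r x x' -> r y y' -> r (a *: x + y) (a *: x' + y')) ->
  (forall x, exists x', r x x') -> (forall x', exists x, r x x') ->
  (forall x x', r x x' -> (x \in I) = (x' \in J)) ->
  exists phi : {linear quotmod I -> quotmod J}, bijective phi.
Proof.
move=> rD /choice[f rf] /choice[g rg] rIJ.
(* The difference of two related pairs is related, so equality of classes transfers both ways: this
   is well-definedness and injectivity at once. *)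
have rE x x' y y' : r x x' -> r y y' ->
    qclass I x = qclass I y <-> qclass J x' = qclass J y'.
  move=> rx ry; rewrite !qclass_eq; have := rIJ _ _ (rD (-1) _ _ _ _ ry rx).
  by rewrite !scaleN1r ![- _ + _]addrC => ->.
pose h (c : quotmod I) : quotmod J := qclass J (f (qrepr c)).
have hE x x' : r x x' -> h (qclass I x) = qclass J x'.
  by move=> rx; apply/(rE _ _ _ _ (rf _) rx); exact: qreprK.
have lh : linear h.
  move=> a x y; rewrite -{1}[x]qreprK -{1}[y]qreprK -(linearP (qclass I)).
  by rewrite (hE _ _ (rD a _ _ _ _ (rf _) (rf _))) linearP.
pose phi : {linear quotmod I -> quotmod J} :=
  HB.pack h (GRing.isLinear.Build F (quotmod I) (quotmod J) _ h lh).
exists phi; exists (fun c => qclass I (g (qrepr c))) => c.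
  rewrite -[RHS]qreprK; apply/(rE _ _ _ _ (rg _) (rf _)); exact: qreprK.
by rewrite [phi _](hE _ _ (rg _)) qreprK.
Qed.

Section BilinearBounds.
Variables (R : realType) (U V W : normedModType R[i]) (f : U -> V -> W).

Lemma bounded_bilinear_gt0 : bounded_bilinear f ->
  exists2 N : R, 0 < N & forall x y, rnorm (f x y) <= N * rnorm x * rnorm y.
Proof.
move=> [_ _ [N fN]]; exists (`|N| + 1) => [|x y]; first by rewrite ltr_wpDl.
apply: le_trans (fN x y) _; rewrite -!mulrA ler_wpM2r ?mulr_ge0 ?rnorm_ge0//.
by rewrite (le_trans (ler_norm N))// lerDl.
Qed.

End BilinearBounds.

(** * Exchanging the two algebras *)

(** The axioms are symmetric, so each result passing from [A] to [B] also serves in the opposite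
    direction. *)
Definition morita_swap (R : realType) (A B : banachAlgType R)
    (M : moritaContext A B) : moritaContext B A :=
  MoritaContext (mc_qp_bounded M) (mc_pq_bounded M)
    (@mc_qp_balanced _ _ _ M) (@mc_pq_balanced _ _ _ M)
    (@mc_qp_lact _ _ _ M) (@mc_qp_ract _ _ _ M)
    (@mc_pq_lact _ _ _ M) (@mc_pq_ract _ _ _ M)
    (@mc_qpq _ _ _ M) (@mc_pqp _ _ _ M).

Lemma full_context_swap (R : realType) (A B : banachAlgType R)
    (M : moritaContext A B) : full_context M -> full_context (morita_swap M).
Proof. by move=> hM; exact: (conj hM.2 hM.1). Qed.

(** * Transfer of derivations between the two algebras *)

Section Transfer.
Variables (R : realType) (A B : banachAlgType R) (M : moritaContext A B).

Local Notation P := (mcP M).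
Local Notation Q := (mcQ M).
Local Notation pq := (mc_pq M).
Local Notation qp := (mc_qp M).

(** A single form serves both derivations; the second condition carries the opposite sign from the
    one defining [Z1M] for [qp]. *)
Definition implemented (D : A -> topdual A) (E : B -> topdual B)
    (psi : P -> Q -> R[i]^o) : Prop :=
  [/\ bounded_bilinear psi,
      forall p q a, D a (pq p q) = psi (blact a p) q - psi p (bract q a)
    & forall p q b, E b (qp q p) = psi (bract p b) q - psi p (blact b q)].

(** Different forms [psi] for the same [D] may give different [E]; these differ by an inner
    derivation. *)
Definition associated D E : Prop :=
  [/\ derivation D, derivation E & exists psi, implemented D E psi].

Lemma bounded_bilinearZD (psi chi : P -> Q -> R[i]^o) c :
  bounded_bilinear psi -> bounded_bilinear chi ->
  bounded_bilinear (fun p q => c *: psi p q + chi p q : R[i]^o).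
Proof.
case=> f1 f2 [N fN] [g1 g2 [K gK]]; split.
- move=> q a p p'; rewrite f1 g1 !scalerDr !scalerA [c * a]mulrC.
  by rewrite addrACA.
- move=> p a q q'; rewrite f2 g2 !scalerDr !scalerA [c * a]mulrC.
  by rewrite addrACA.
exists (rnorm c * N + K) => p q; apply: (le_trans (ler_rnormD _ _)).
by rewrite !mulrDl rnormZ -!mulrA lerD ?ler_wpM2l ?rnorm_ge0// ?mulrA.
Qed.

Lemma associatedZD c D D' E E' :
  associated D E -> associated D' E' -> associated (c *: D + D') (c *: E + E').
Proof.
move=> [dD dE [psi [bpsi hD hE]]] [dD' dE' [chi [bchi hD' hE']]].
split; [exact: derivationZD..|].
exists (fun p q => c *: psi p q + chi p q); split.
- exact: bounded_bilinearZD.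
- move=> p q a; rewrite -[(c *: D + D') a]/(c *: D a + D' a) dualDE dualZE.
  by rewrite hD hD' scalerBr opprD addrACA.
- move=> p q b; rewrite -[(c *: E + E') b]/(c *: E b + E' b) dualDE dualZE.
  by rewrite hE hE' scalerBr opprD addrACA.
Qed.

Hypothesis fullM : full_context M.

Let qp_iso : @implements_iso R A (bimod_right Q) (bimod_left P) B qp := fullM.2.

Let qp_eq (h k : topdual B) : (forall q p, h (qp q p) = k (qp q p)) -> h = k.
Proof. exact: (topdual_eq qp_iso). Qed.

(** Evaluated at [qp q p], the two terms of the product rule telescope:
    [psi (bract p b) (blact b' q)] cancels. *)
Lemma associated_derivation D E psi :
  bounded_linear E -> implemented D E psi -> derivation E.
Proof.
move=> bE [_ _ hE]; split=> // b b'; apply: qp_eq => q p.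
rewrite dualDE dual_lactE dual_ractE -mc_qp_ract -mc_qp_lact !hE.
by rewrite bractA blactA addrA subrK.
Qed.

Lemma associated_ex D : morita_derivation pq D -> exists E, associated D E.
Proof.
move=> [dD [psi [bpsi hD]]].
have [N N0 psiN] := bounded_bilinear_gt0 bpsi; have [psil psir _] := bpsi.
have [C C0 actC] := bounded_bilinear_gt0 (bract_bounded P).
have [C' C'0 actC'] := bounded_bilinear_gt0 (blact_bounded Q).
have [actl actr _] := bract_bounded P.
have [actl' actr' _] := blact_bounded Q.
have [K K0 liftK] := topdual_lift qp_iso.
pose g b (q : Q) (p : P) : R[i]^o := psi (bract p b) q - psi p (blact b q).
(* The norm bound is kept linear in [rnorm b]; [C] and [C'] bound the actions of [B] on [P] and on
   [Q]. *)
have E_ex b : exists h : topdual B, (forall q p, h (qp q p) = g b q p) /\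
    dnormR h <= N * (C + C') * rnorm b * K.
  have [|||||h hE hK] := liftK (g b) (N * (C + C') * rnorm b).
  - by rewrite !mulr_ge0 ?rnorm_ge0 ?addr_ge0 ?ltW.
  - move=> p c q q'; rewrite /g psir actr' psir.
    by rewrite scalerBr opprD addrACA.
  - move=> q c p p'; rewrite /g actl psil psil.
    by rewrite scalerBr opprD addrACA.
  - move=> q p; apply: le_trans (ler_rnormD _ _) _; rewrite rnormN.
    have -> : N * (C + C') * rnorm b * rnorm q * rnorm p =
        N * (C * rnorm p * rnorm b) * rnorm q +
        N * rnorm p * (C' * rnorm b * rnorm q) by ring.
    apply: lerD; apply: le_trans (psiN _ _) _.
      by rewrite ler_wpM2r ?rnorm_ge0// ler_wpM2l// ltW.
    by rewrite ler_wpM2l// mulr_ge0 ?rnorm_ge0// ltW.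
  - move=> q a p; rewrite /g /= blractA.
    (* [D a] at [pq (bract p b) q] is expanded twice, the second time as [pq p (blact b q)];
       equating the results is the balance condition rearranged. *)
    have := hD (bract p b) q a; rewrite mc_pq_balanced hD blractA => e.
    apply/eqP; rewrite subr_eq -addrA [- _ + _]addrC -opprB e opprB.
    by rewrite addrC subrK.
  by exists h.
have [E hE] := choice E_ex.
exists E.
have bE : bounded_linear E.
  (* Linearity in [b] need only be tested on the values of [qp], where it comes from linearity of
     the actions and of [psi]. *)
  split.
    move=> c b b'; apply: qp_eq => q p; rewrite dualDE dualZE !(hE _).1 /g.
    rewrite actr psil actl' psir.
    by rewrite scalerBr opprD addrACA.
  exists (N * (C + C') * K) => b; apply: le_trans (hE b).2 _.
  by rewrite mulrAC.
have impl : implemented D E psi by split=> // p q b; exact: (hE b).1.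
by split; [|exact: associated_derivation impl|exists psi].
Qed.

Lemma associated_inner D E : associated D E -> inner_derivation D ->
  inner_derivation E.
Proof.
move=> [_ dE [psi [bpsi hD hE]]] [_ [f Df]]; split=> //.
have [lf [Cf fC]] := dualP f.
have [pql pqr _] := mc_pq_bounded M.
have [psil psir _] := bpsi.
have [K K0 liftK] := topdual_lift qp_iso.
have [Np Np0 psiN] := bounded_bilinear_gt0 bpsi.
have [Nq Nq0 pqN] := bounded_bilinear_gt0 (mc_pq_bounded M).
have Cf1 : 0 < `|Cf| + 1 by rewrite ltr_wpDl.
pose chi (q : Q) (p : P) : R[i]^o := psi p q + f (pq p q).
(* The summands bound [psi] and the composite of [f] with [pq]; [Cf] may be negative, hence the
   absolute value and the 1. *)
have [|||||h hchi _] := liftK chi (Np + (`|Cf| + 1) * Nq).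
- by rewrite addr_ge0 ?mulr_ge0 ?ltW.
- by move=> p c q q'; rewrite /chi psir pqr lf scalerDr addrACA.
- by move=> q c p p'; rewrite /chi psil pql lf scalerDr addrACA.
- move=> q p; apply: le_trans (ler_rnormD _ _) _; rewrite 2!mulrDl lerD//.
    by rewrite mulrAC.
  apply: le_trans (fC _) _.
  apply: (@le_trans _ _ ((`|Cf| + 1) * rnorm (pq p q))).
    by rewrite ler_wpM2r ?rnorm_ge0// (le_trans (ler_norm Cf))// lerDl.
  rewrite -!mulrA (ler_wpM2l (ltW Cf1))// [rnorm q * _]mulrC mulrA; exact: pqN.
- move=> q a p; rewrite /chi /=; apply/esym/subr0_eq.
  (* Innerness turns the left side into [f (pq p (bract q a)) - f (pq (blact a p) q)], which is what
     balances [chi]. *)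
  have := hD p q a; rewrite Df dualBE dual_lactE dual_ractE.
  rewrite -mc_pq_lact -mc_pq_ract => e.
  by rewrite opprD addrACA -e subrKA subrr.
exists h => b; apply: qp_eq => q p; rewrite dualBE dual_lactE dual_ractE hE.
(* The two values of [f] agree because [pq] is balanced, so only the [psi] terms survive. *)
rewrite -mc_qp_ract -mc_qp_lact !hchi /chi mc_pq_balanced.
by rewrite opprD addrACA subrr addr0.
Qed.

End Transfer.

Lemma associated_swap (R : realType) (A B : banachAlgType R)
    (M : moritaContext A B) D E :
  associated M D E -> associated (morita_swap M) E D.
Proof.
move=> [dD dE [psi [bpsi hD hE]]]; split => //.
(* Swapping the arguments reverses the order of the two terms in each difference; the sign restores
   it. *)
exists (fun q p => - psi p q); split.
- have [psil psir [N psiN]] := bpsi; split.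
  + by move=> p c q q'; rewrite psir opprD scalerN.
  + by move=> q c p p'; rewrite psil opprD scalerN.
  + by exists N => q p; rewrite rnormN mulrAC.
- by move=> q p b; rewrite /= hE opprK addrC.
- by move=> q p a; rewrite /= hD opprK addrC.
Qed.

Lemma associated_morita (R : realType) (A B : banachAlgType R)
    (M : moritaContext A B) D E :
  associated M D E -> D \in Z1M (mc_pq M).
Proof.
by move=> [dD _ [psi [bpsi hD _]]]; apply/asboolP; split => //; exists psi.
Qed.

Theorem theorem2p13 (R : realType) (A B : banachAlgType R)
    (hA : self_induced A) (hB : self_induced B)
    (M : moritaContext A B) (hM : full_context M) :
  exists phi : {linear H1M (mc_pq M) -> H1M (mc_qp M)}, bijective phi.
Proof.
pose r (D : submod (Z1M (mc_pq M))) (E : submod (Z1M (mc_qp M))) :=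
  associated M (sval D) (sval E).
have hM' := full_context_swap hM.
apply: (@quotmod_iso _ _ _ _ _ r).
- by move=> a D E D' E'; exact: associatedZD.
- move=> [D ZD]; have [E DE] := associated_ex hM (asboolW ZD).
  (* [E] lies in [Z1M (mc_qp M)] because the swapped association exhibits a form for it. *)
  by exists (exist _ E (associated_morita (associated_swap DE))).
- move=> [E ZE]; have [D DE] := associated_ex hM' (asboolW ZE).
  exists (exist _ D (associated_morita (associated_swap DE))).
  (* Swapping twice restores every projection of [M] by computation, and [associated] depends on [M]
     only through projections. *)
  exact: associated_swap DE.
- move=> D E DE; apply/asboolP/asboolP => [|]; first exact: (associated_inner hM DE).
  exact: (associated_inner hM' (associated_swap DE)).
Qed.
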